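(* Let $\theta>0$ and let $\mathcal{L}$ be the uniform distribution on the unit circle. The 2-correlation measure $\tilde\tau_\infty^{[2]}$ on $\mathbb{R}^2$ has a density $\rho$ with respect to the Lebesgue measure, given by $$\rho(x,y)=\phi_\theta(x-y),$$ where the function $\phi_\theta$ on $\mathbb{R}$ is defined (up to a Lebesgue-null set) by $$\phi_\theta(x)=\frac{\theta}{\theta+1}+\frac{\theta}{x^2}\sum_{a\in\mathbb{N}^*,\,a\le|x|}a\left(1-\frac{a}{|x|}\right)^{\theta-1}.$$
   Context: For $\mathcal{L}$ uniform on the unit circle, $\tau_\infty(\theta,\mathcal{L})$ is the random point measure on $\mathbb{R}$ $$\tau_\infty(\theta,\mathcal{L})=\sum_{m=1}^\infty\sum_{k\in\mathbb{Z}}\delta_{(k+\chi_m)/x_m},$$ where $(x_m)_{m\ge1}$ is a Poisson-Dirichlet process of parameter $\theta$ and $(\chi_m)_{m\ge1}$ is an independent sequence of i.i.d. uniform random variables on $[0,1)$. (A Poisson-Dirichlet process of parameter $\theta$ has the law of the decreasing rearrangement of the GEM($\theta$) sequence $y_m=V_m\prod_{i<m}(1-V_i)$, with $(V_i)$ i.i.d. of density $\theta(1-x)^{\theta-1}$ on $(0,1)$.) The 2-correlation measure $\tilde\tau_\infty^{[2]}$ is the expectation of the random measure $\sum_{j_1\ne j_2}\delta_{(t_{j_1},t_{j_2})}$ on $\mathbb{R}^2$, where $\tau_\infty(\theta,\mathcal{L})=\sum_{j\ge1}\delta_{t_j}$ and the sum is over pairs of distinct indices. $\mathbb{N}^*$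 is the set of positive integers. *)

(* Defs.v *)
From mathcomp Require Import all_boot all_order all_algebra.
From mathcomp Require Import all_classical all_reals all_analysis.
Set Implicit Arguments.
Unset Strict Implicit.
Unset Printing Implicit Defensive.
Import Order.TTheory GRing.Theory Num.Theory.
Import numFieldNormedType.Exports.
Local Open Scope classical_set_scope.
Local Open Scope ring_scope.

Section sequences_of_random_variables.
Context {R : realType}.

(* The product sigma-algebra on R^nat. *)
Definition seq_measurable : set (set (nat -> R)) :=
  <<s \bigcup_(i in [set: nat])
        preimage_set_system setT (fun u : nat -> R => u i) measurable >>.

Definition same_law d (T : measurableType d) (P : probability T R)
    d' (T' : measurableType d') (P' : probability T' R)
    (X : nat -> {RV P >-> R}) (X' : nat -> {RV P' >-> R}) : Prop :=
  forall A, seq_measurable A ->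
    P [set w | A (fun i => X i w)] = P' [set w | A (fun i => X' i w)].

Context d (T : measurableType d) (P : probability T R).

Definition independent_seqs (X Y : nat -> {RV P >-> R}) : Prop :=
  forall A B, seq_measurable A -> seq_measurable B ->
    P ([set w | A (fun i => X i w)] `&` [set w | B (fun i => Y i w)])
    = (P [set w | A (fun i => X i w)] * P [set w | B (fun i => Y i w)])%E.

Definition mutually_independent (X : nat -> {RV P >-> R}) : Prop :=
  forall (s : seq nat) (A : nat -> set R), uniq s ->
    (forall i, measurable (A i)) ->
    P (\bigcap_(i in [set` s]) (X i @^-1` A i))
    = (\prod_(i <- s) P (X i @^-1` A i))%E.

Definition has_density_on (X : {RV P >-> R}) (D : set R) (f : R -> R) : Prop :=
  forall A : set R, measurable A ->
    distribution P X A = (\int[lebesgue_measure]_(v in A `&` D) (f v)%:E)%E.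

Definition iid_with_density (X : nat -> {RV P >-> R}) (D : set R)
    (f : R -> R) : Prop :=
  mutually_independent X /\ forall i, has_density_on (X i) D f.

Definition iid_uniform (X : nat -> {RV P >-> R}) : Prop :=
  iid_with_density X `[0, 1[ (fun=> 1).

End sequences_of_random_variables.

Section poisson_dirichlet.
Context {R : realType}.

Definition gem_seq (v : nat -> R) (m : nat) : R :=
  v m * \prod_(i < m) (1 - v i).

Definition decreasing_rearrangement (y x : nat -> R) : Prop :=
  nonincreasing_seq x /\
  exists2 s : nat -> nat, bijective s & forall m, x m = y (s m).

(* Only the law of x matters: the GEM sequence may live on another probability
   space.  Sequences are indexed from 0. *)
Definition poisson_dirichlet d (T : measurableType d) (P : probability T R)
    (theta : R) (x : nat -> {RV P >-> R}) : Prop :=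
  exists (d' : measure_display) (T' : measurableType d')
         (P' : probability T' R) (V x' : nat -> {RV P' >-> R}),
    [/\ iid_with_density V `]0, 1[
          (fun v => theta * (1 - v) `^ (theta - 1)),
        {ae P', forall w, decreasing_rearrangement
           (gem_seq (fun i => V i w)) (fun m => x' m w)} &
        same_law x x'].

End poisson_dirichlet.

Section correlation.
Context {R : realType} d (T : measurableType d) (P : probability T R).

(* The atoms of tau_infty, listed by the pairs (m, k); on the null event
   x m w = 0 the value is irrelevant. *)
Definition tau_atoms (x chi : nat -> {RV P >-> R}) (j : nat * int) (w : T) : R :=
  (j.2%:~R + chi j.1 w) / x j.1 w.

(* Pairs with distinct indices, not distinct positions: atoms are counted with
   multiplicity. *)
Definition correlation2 (I : choiceType) (t : I -> T -> R)
    (A : set (R * R)) : \bar R :=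
  (\int[P]_w \esum_(j in [set j : I * I | j.1 <> j.2])
      \d_(t j.1 w, t j.2 w) A)%E.

End correlation.

Definition has_density d (T : measurableType d) (R : realType)
    (mu : {measure set T -> \bar R}) (nu : set T -> \bar R) (f : T -> R) :
    Prop :=
  [/\ measurable_fun setT f, forall z, 0 <= f z &
      forall A, measurable A -> nu A = (\int[mu]_(z in A) (f z)%:E)%E].

(* At x = 0, and where the formula is infinite (theta < 1, |x| a positive
   integer), this takes arbitrary finite values; those x form a null set. *)
Definition phi (R : realType) (theta x : R) : R :=
  theta / (theta + 1) +
  theta / x ^+ 2 *
    \sum_(1 <= a < (Num.truncn `|x|).+1)
       a%:R * (1 - a%:R / `|x|) `^ (theta - 1).

(* Main.v *)
Require Import Defs.
From mathcomp Require Import all_boot all_order all_algebra.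
From mathcomp Require Import all_classical all_reals all_analysis.
From mathcomp Require Import measurable_realfun.
From mathcomp Require Import ring lra.
Set Implicit Arguments.
Unset Strict Implicit.
Unset Printing Implicit Defensive.
Import Order.TTheory GRing.Theory Num.Theory.
Import numFieldNormedType.Exports.
Local Open Scope classical_set_scope.
Local Open Scope ring_scope.

(** Split the pairs of distinct atoms [(k + chi_m) / x_m], [(l + chi_n) / x_n]
    according to whether [m = n].  Summing over [k] the law of [k + chi_m] with
    [chi_m] uniform on [0, 1) gives Lebesgue measure on the line
    ([lattice_sum]), so that, given [x], each comb of atoms has intensity [x_m].

    If [m <> n], the phases are independent, and the pairs of atoms of the
    combs [m] and [n] have intensity [x_m x_n] times Lebesgue measure on the
    plane ([distinct_periods]).  This gives the constant term of [phi], as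
    [sum_(m <> n) x_m x_n] is [sum_m x_m (1 - x_m)], of mean
    [theta / (theta + 1)] ([pd_pairs]).

    If [m = n], the second atom is at distance [a / x_m] from the first one,
    with [a] a nonzero integer.  Write [D r] for the length of the part of [A]
    on the line [t - s = r].  Such pairs contribute [x_m D(a / x_m)] in mean
    ([same_period]).  The sum over [m] of [x_m g(x_m)] has the same mean as [g]
    at a size-biased pick from [x], and this pick has the density of one stick,
    [theta (1 - v)^(theta - 1)] on (0, 1) ([pd_size_bias]).  The substitution
    [r = a / v] turns the integral of [D(a / v)] against that density into the
    integral of [D r] against [theta |a| / r^2 (1 - a / r)^(theta - 1)] on
    [0 < a / r <= 1] ([integral_gap]).  The terms [a] and [- a] together are one
    summand of [phi] ([gap_pdf_pair]).

    The size-biased pick is computed from the GEM sequence [y] itself.  Let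
    [W_n] be the length left after [n] sticks.  If [Y] is independent of [W_n]
    and has the density of a stick, then
    [E W_n g(W_n Y) = E y_n g(y_n) + E W_(n+1) g(W_(n+1) Y)] ([gem_step]): a
    size-biased pick from what is left is either the next stick or a
    size-biased pick from the rest.  The integral identity behind this is a
    Beta convolution ([stick_convolution]).  As [E W_n] tends to 0, summing over
    [n] leaves [E g(Y) = sum_n E y_n g(y_n)] ([gem_size_bias]).

    All substitutions are derived from affine invariance of Lebesgue measure
    and Tonelli's theorem.  The inversion [v = 1 / r] follows from the
    scale invariance of [dv / |v|] ([integral_haar_inv]).  All integrands are
    kept nonnegative everywhere, by absolute values, so that Tonelli's theorem
    applies without integrability conditions. *)

(** * Measurability of explicit functions *)

Section measurability.
Context d (T : measurableType d) (R : realType).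
Implicit Types f g : T -> R.

(** Inversion is not continuous at 0; it is nevertheless a product of measurable
    functions, since [1 / a = a * (|a| ^ (-1)) ^ 2] holds also for [a = 0]. *)
Lemma measurable_funV f :
  measurable_fun setT f -> measurable_fun setT (fun x => (f x)^-1).
Proof.
move=> mf.
have -> : (fun x => (f x)^-1) = (fun x => f x * (`|f x| `^ (-1)) ^+ 2).
  apply/funext => x; have [->|fx0] := eqVneq (f x) 0;
    first by rewrite invr0 mul0r.
  rewrite powR_inv1// exprVn real_normK ?num_real// expr2 invfM mulrA divff//.
  by rewrite mul1r.
apply: measurable_funM => //; apply: measurable_funX.
apply: (measurableT_comp (measurable_powR (-1))).
exact: measurableT_comp.
Qed.

Lemma measurable_funPow f a :
  measurable_fun setT f -> measurable_fun setT (fun x => f x `^ a).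
Proof. by move=> mf; exact: (measurableT_comp (measurable_powR a)). Qed.

Lemma measurable_fun_norm f :
  measurable_fun setT f -> measurable_fun setT (fun x => `|f x|).
Proof. by move=> mf; exact: measurableT_comp. Qed.

Lemma measurable_fun_EFin f :
  measurable_fun setT f -> measurable_fun setT (fun x => (f x)%:E).
Proof. by move=> mf; apply/measurable_EFinP. Qed.

Lemma measurable_fun_indic_comp d' (T' : measurableType d') (X : T -> T') A :
  measurable A -> measurable_fun setT X ->
  measurable_fun setT (fun x => (\1_A (X x) : R)).
Proof.
by move=> mA mX; exact: (measurableT_comp (@measurable_indic _ _ R setT A mA)).
Qed.

End measurability.

(** Decomposes a function along its head symbol, down to measurable functions
    found among the hypotheses.  The arguments are passed explicitly, because
    unification would return them in eta-reduced form, which no pattern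
    matches. *)
Ltac meas_step :=
  lazymatch goal with
  | |- measurable_fun _ (fun x => EFin (@?f x)) =>
      refine (measurable_fun_EFin (f := f) _)
  | |- measurable_fun _ (fun x => mule (@?f x) (@?g x)) =>
      refine (emeasurable_funM (f := f) (g := g) _ _)
  | |- measurable_fun _ (fun x => GRing.mul (@?f x) (@?g x)) =>
      refine (measurable_funM (f := f) (g := g) _ _)
  | |- measurable_fun _ (fun x => GRing.add (@?f x) (GRing.opp (@?g x))) =>
      refine (measurable_funB (f := f) (g := g) _ _)
  | |- measurable_fun _ (fun x => GRing.add (@?f x) (@?g x)) =>
      refine (measurable_funD (f := f) (g := g) _ _)
  | |- measurable_fun _ (fun x => GRing.opp (@?f x)) =>
      refine (measurable_funN (f := f) _)
  | |- measurable_fun _ (fun x => GRing.inv (@?f x)) =>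
      refine (measurable_funV (f := f) _)
  | |- measurable_fun _ (fun x => GRing.exp (@?f x) _) =>
      refine (measurable_funX (f := f) _ _)
  | |- measurable_fun _ (fun x => powR (@?f x) _) =>
      refine (measurable_funPow (f := f) _ _)
  | |- measurable_fun _ (fun x => Num.norm (@?f x)) =>
      refine (measurable_fun_norm (f := f) _)
  | |- measurable_fun _ (fun x => if _ then _ else _) =>
      apply: measurable_fun_ifT
  | |- measurable_fun _ (fun x => andb (@?f x) (@?g x)) =>
      refine (measurable_and (f := f) (g := g) _ _)
  | |- measurable_fun _ (fun x => Order.lt (@?f x) (@?g x)) =>
      refine (measurable_fun_ltr (f := f) (g := g) _ _)
  | |- measurable_fun _ (fun x => Order.le (@?f x) (@?g x)) =>
      refine (measurable_fun_ler (f := f) (g := g) _ _)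
  | |- measurable_fun _ (Order.lt ?a) =>
      refine (measurable_fun_ltr (f := fun=> a) (g := fun x => x) _ _)
  | |- measurable_fun _ (Order.le ?a) =>
      refine (measurable_fun_ler (f := fun=> a) (g := fun x => x) _ _)
  | |- measurable_fun _ (fun x => pair (@?f x) (@?g x)) =>
      refine (measurable_fun_pair (f := f) (g := g) _ _)
  | |- measurable_fun _ (fun x => indic _ (@?f x)) =>
      refine (measurable_fun_indic_comp (X := f) _ _)
  | |- measurable_fun _ (fun x => x) => apply: measurable_id
  | |- measurable_fun _ (fun x => fst x) => apply: measurable_fst
  | |- measurable_fun _ (fun x => snd x) => apply: measurable_snd
  | |- measurable_fun _ (fun x => fst (@?f x)) =>
      refine (measurableT_comp (g := f) measurable_fst _)
  | |- measurable_fun _ (fun x => snd (@?f x)) =>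
      refine (measurableT_comp (g := f) measurable_snd _)
  | |- measurable_fun _ (fun _ => ?c) => apply: measurable_cst
  | H : measurable_fun _ ?h |- measurable_fun _ ?h => exact: H
  | H : measurable_fun _ ?h |- measurable_fun _ (fun x => ?h (@?g x)) =>
      refine (measurableT_comp (g := g) H _)
  | H : measurable ?A |- measurable ?A => exact: H
  | |- measurable _ => exact: measurable_itv
  end.
Ltac meas := repeat meas_step.

(** * Invariance of Lebesgue measure *)

(** The image measure as a bundled measure: the structure found by unification
    for [pushforward] leaves the measurability of [f] as a pending goal. *)
Definition push_measure d1 d2 (T1 : measurableType d1) (T2 : measurableType d2)
  (R : realType) (mu : {measure set T1 -> \bar R}) (f : T1 -> T2)
  (mf : measurable_fun setT f) : {measure set T2 -> \bar R} :=
  measure_function_pushforward__canonical__measure_function_Measure mu mf.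

Lemma integral_push_measure d1 d2 (T1 : measurableType d1)
  (T2 : measurableType d2) (R : realType) (mu : {measure set T1 -> \bar R})
  (f : T1 -> T2) (mf : measurable_fun setT f) (h : T2 -> \bar R) :
  measurable_fun setT h -> (forall x, 0 <= h x)%E ->
  (\int[push_measure mu mf]_x h x = \int[mu]_x h (f x))%E.
Proof. by move=> mh h0; rewrite ge0_integral_pushforward. Qed.

Section lebesgue.
Context {R : realType}.
Local Notation lam := (@lebesgue_measure R).
Implicit Types h : R -> \bar R.
Local Open Scope ereal_scope.

Lemma measurable_affine (c b : R) :
  measurable_fun setT (fun x : R => (c * x + b)%R).
Proof. by meas. Qed.

Lemma lebesgue_affine (c b : R) A : c != 0%R -> measurable A ->
  `|c|%:E * lam ((fun x : R => (c * x + b)%R) @^-1` A) = lam A.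
Proof.
move=> c0 mA; pose g : measurableTypeR R ->
  measurableTypeR R := fun x => (c * x + b)%R.
have mg : measurable_fun setT g by exact: measurable_affine.
pose m := mscale (NngNum (normr_ge0 c)) (push_measure lam mg).
rewrite -[LHS]/(m A); apply/esym/lebesgue_measure_unique => // _ [[p q]] _ <-.
rewrite /m /mscale/= /push_measure/= /pushforward.
have [pq|qp] := leP q p; first by rewrite set_itv_ge ?preimage_set0 ?measure0
  ?mule0 ?bnd_simp -?leNgt.
rewrite [X in _ = _ * lam X](_ : _ = if (0 < c)%R then `]((p - b) / c)%R,
  ((q - b) / c)%R]%classic else
   `[((q - b) / c)%R, ((p - b) / c)%R[%classic); last first.
  apply/seteqP; rewrite /g; case: ltP => [cp|cn]; split=> x /=;
    rewrite !in_itv/=.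
  - by rewrite ltr_pdivrMr// ler_pdivlMr// ltrBlDr lerBrDr mulrC.
  - by rewrite ltr_pdivrMr// ler_pdivlMr// ltrBlDr lerBrDr mulrC.
  - have cl : (c < 0)%R by rewrite lt_neqAle c0.
    by rewrite ltr_ndivlMr// ler_ndivrMr// ltrBlDr lerBrDr mulrC andbC.
  - have cl : (c < 0)%R by rewrite lt_neqAle c0.
    by rewrite ltr_ndivlMr// ler_ndivrMr// ltrBlDr lerBrDr mulrC andbC.
case: ltP => [cp|cn].
  rewrite !lebesgue_measure_itv/= !lte_fin ltr_pM2r ?invr_gt0// ltrD2r qp.
  by rewrite gtr0_norm// -!EFinD -EFinM; congr EFin; field.
have cl : (c < 0)%R by rewrite lt_neqAle c0.
rewrite !lebesgue_measure_itv/= !lte_fin ltr_nM2r ?invr_lt0// ltrD2r qp.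
by rewrite ltr0_norm// -!EFinD -EFinM; congr EFin; field.
Qed.

Lemma integral_affine (c b : R) h : c != 0%R ->
  measurable_fun setT h -> (forall x, 0 <= h x) ->
  `|c|%:E * \int[lam]_x h (c * x + b)%R = \int[lam]_x h x.
Proof.
move=> c0 mh h0; pose g : measurableTypeR R ->
  measurableTypeR R := fun x => (c * x + b)%R.
have mg : measurable_fun setT g by exact: measurable_affine.
pose m := mscale (NngNum (normr_ge0 c)) (push_measure lam mg).
transitivity (\int[m]_x h x).
  by rewrite ge0_integral_mscale// integral_push_measure.
by apply: eq_measure_integral => A mA _; exact: lebesgue_affine.
Qed.

Lemma integral_shift (b : R) h :
  measurable_fun setT h -> (forall x, 0 <= h x) ->
  \int[lam]_x h (x + b)%R = \int[lam]_x h x.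
Proof.
move=> mh h0; rewrite -(@integral_affine 1 b h)// normr1 mul1e.
by under [RHS]eq_integral do rewrite mul1r.
Qed.

Lemma integral_scale (c : R) h : c != 0%R ->
  measurable_fun setT h -> (forall x, 0 <= h x) ->
  \int[lam]_x h (c * x)%R = `|c|^-1%:E * \int[lam]_x h x.
Proof.
move=> c0 mh h0; rewrite -(@integral_affine c 0 h)// muleA -EFinM mulVf
  ?normr_eq0// mul1e.
by under [RHS]eq_integral do rewrite addr0.
Qed.

Lemma fubini_swap d1 d2 (T1 : measurableType d1) (T2 : measurableType d2)
  (m1 : {sigma_finite_measure set T1 -> \bar R})
  (m2 : {sigma_finite_measure set T2 -> \bar R}) (f : T1 -> T2 -> \bar R) :
  measurable_fun setT (fun z => f z.1 z.2) -> (forall x y, 0 <= f x y) ->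
  \int[m1]_x \int[m2]_y f x y = \int[m2]_y \int[m1]_x f x y.
Proof.
by move=> mf f0; rewrite (@fubini_tonelli _ _ _ _ _ m1 m2 (fun z => f z.1 z.2)).
Qed.

Lemma measurable_integral d1 d2 (T1 : measurableType d1) (T2 : measurableType
  d2)
  (m2 : {sigma_finite_measure set T2 -> \bar R}) (f : T1 -> T2 -> \bar R) :
  measurable_fun setT (fun z => f z.1 z.2) -> (forall x y, 0 <= f x y) ->
  measurable_fun setT (fun x => \int[m2]_y f x y).
Proof.
move=> mf f0.
exact: (@measurable_fun_fubini_tonelli_F _ _ _ _ _ m2 (fun z => f z.1 z.2)).
Qed.

(** The measure [dx / |x|] is the Haar measure of the multiplicative group.
    Since [0^-1 = 0], the origin carries no weight and the integrals may run
    over the whole line. *)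
Lemma integral_haar_scale (c : R) h : c != 0%R ->
  measurable_fun setT h -> (forall x, 0 <= h x) ->
  \int[lam]_x (`|x|^-1%:E * h (c * x)%R) = \int[lam]_x (`|x|^-1%:E * h x).
Proof.
move=> c0 mh h0.
pose k x := (`|c|%:E * (`|x|^-1%:E * h x)).
have mk : measurable_fun setT (fun x : R => `|x|^-1%:E * h x) by meas.
have k0 x : 0 <= `|x|^-1%:E * h x by rewrite mule_ge0// lee_fin invr_ge0.
transitivity (\int[lam]_x k (c * x)%R).
  apply: eq_integral => x _; rewrite /k normrM invfM muleA -EFinM.
  by rewrite mulrA divff ?normr_eq0// mul1r.
rewrite integral_scale//; last 2 first.
  by rewrite /k; meas.
  by move=> x; rewrite mule_ge0.
by rewrite ge0_integralZl// muleA -EFinM mulVf ?normr_eq0// mul1e.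
Qed.

(** Haar measure is invariant under inversion. With [C] the integral of a test
    function [k], the product of [C] and the left-hand side is the double
    integral of [h(1/v) k(w)]; scaling [w] by [v], then [v] by [1/w], then [w]
    by [v] turns the integrand successively into [h(1/v) k(v w)], [h(w/v) k(v)]
    and [h(w) k(v)]. For the indicator [k] of [1, 2] the constant [C] is
    positive and finite and can be cancelled. *)
Lemma integral_haar_inv h :
  measurable_fun setT h -> (forall x, 0 <= h x) ->
  \int[lam]_x (`|x|^-1%:E * h x^-1%R) = \int[lam]_x (`|x|^-1%:E * h x).
Proof.
move=> mh h0.
have w0 (x : R) : 0 <= `|x|^-1%:E by rewrite lee_fin invr_ge0.
pose k (x : R) : \bar R := (\1_(`[1%R, 2%R]%classic : set R) x)%:E.
have mI : measurable (`[1%R, 2%R]%classic : set R) by exact: measurable_itv.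
have mk : measurable_fun setT k by rewrite /k; meas.
have Ik : \int[lam]_x k x = 1.
  rewrite /k integral_indic// setIT [LHS]lebesgue_measure_itv/= lte_fin ltr1n
    -EFinD; congr EFin; lra.
have k0 x : 0 <= k x by rewrite lee_fin.
pose C := \int[lam]_x (`|x|^-1%:E * k x).
have C0 : 0 < C.
  have : 0 < \int[lam]_x ((2^-1)%:E * k x).
    by rewrite ge0_integralZl// Ik mule1 lte_fin invr_gt0.
  move/lt_le_trans; apply; apply: ge0_le_integral => //.
  - by move=> x _; rewrite mule_ge0// lee_fin invr_ge0.
  - by meas.
  - by meas.
  - move=> x _; rewrite /k indicE; case: (boolP (_ \in _));
      last by rewrite !mule0.
    rewrite inE/= in_itv/= => /andP[x1 x2]; rewrite !mule1 lee_fin.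
    by rewrite ger0_norm ?(le_trans _ x1)// lef_pV2 ?posrE// (lt_le_trans _ x1).
have Coo : C < +oo.
  apply: (@le_lt_trans _ _ (\int[lam]_x k x)).
    apply: ge0_le_integral => //.
    - by move=> x _; rewrite mule_ge0.
    - by meas.
    - move=> x _; rewrite /k indicE; case: (boolP (_ \in _));
        last by rewrite !mule0.
      rewrite inE/= in_itv/= => /andP[x1 x2]; rewrite !mule1 lee_fin.
      by rewrite ger0_norm ?(le_trans _ x1)// invf_le1 ?(lt_le_trans _ x1).
  by rewrite Ik ltry.
have Cfin : C \is a fin_num by rewrite ge0_fin_numE// ltW.
suff E : \int[lam]_x (`|x|^-1%:E * h x^-1%R) * C =
  \int[lam]_x (`|x|^-1%:E * h x) * C.
  have := congr1 (fun y => y * (fine C)^-1%:E) E.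
  by rewrite -!muleA -{1 3}(fineK Cfin) -EFinM divff ?mule1// gt_eqF//
    fine_gt0// C0.
have mhV : measurable_fun setT (fun x : R => h x^-1%R).
  by meas.
transitivity (\int[lam]_v \int[lam]_w (`|v|^-1%:E * (`|w|^-1%:E * (h v^-1%R *
  k (v * w)%R)))).
  rewrite -ge0_integralZr//; last 3 first.
  - by meas.
  - by move=> x _; rewrite mule_ge0.
  - exact: ltW.
  apply: eq_integral => v _; rewrite -muleA.
  have mkv : measurable_fun setT (fun w : R => k (v * w)%R).
    by meas.
  rewrite ge0_integralZl//; last 2 first.
  - by meas.
  - by move=> x _; rewrite !mule_ge0.
  have [->|v0] := eqVneq v 0%R; first by rewrite normr0 invr0 !mul0e.
  congr (_ * _).
  under eq_integral do rewrite muleCA.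
  rewrite ge0_integralZl//; last 2 first.
  - by meas.
  - by move=> x _; rewrite !mule_ge0.
  by rewrite integral_haar_scale.
rewrite fubini_swap; last 2 first.
- by meas.
- by move=> *; rewrite !mule_ge0.
transitivity (\int[lam]_w \int[lam]_v (`|w|^-1%:E * (`|v|^-1%:E * (h (w *
  v^-1)%R * k v)))).
  apply: eq_integral => w _.
  have [->|w0'] := eqVneq w 0%R.
    by apply: eq_integral => v _; rewrite normr0 invr0 !mul0e mule0.
  have mhw : measurable_fun setT (fun v : R => h (w * v^-1)%R).
    by meas.
  have mkw : measurable_fun setT (fun v : R => k (v * w)%R).
    by meas.
  under eq_integral do rewrite muleCA.
  rewrite ge0_integralZl//; last 2 first.
  - by meas.
  - by move=> x _; rewrite !mule_ge0.
  rewrite ge0_integralZl//; last 2 first.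
  - by meas.
  - by move=> x _; rewrite !mule_ge0.
  congr (_ * _); rewrite -[RHS](@integral_haar_scale w)//; last 2 first.
  - by meas.
  - by move=> x; rewrite mule_ge0.
  apply: eq_integral => v _; congr (_ * (h _ * k _)); last by rewrite mulrC.
  by rewrite invfM mulrA divff// mul1r.
rewrite fubini_swap; last 2 first.
- by meas.
- by move=> *; rewrite !mule_ge0.
rewrite muleC -ge0_integralZr//; last 3 first.
- by meas.
- by move=> x _; rewrite mule_ge0.
- by apply: integral_ge0 => x _; rewrite mule_ge0.
apply: eq_integral => v _.
have [->|v0] := eqVneq v 0%R.
  rewrite normr0 invr0 !mul0e.
  by apply: integral0_eq => w _; rewrite mul0e mule0.
rewrite -muleA -(@integral_haar_scale v^-1)// ?invr_eq0//.
have mhv : measurable_fun setT (fun w : R => h (v^-1 * w)%R).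
  by meas.
rewrite muleA -ge0_integralZl//; last 3 first.
- by meas.
- by move=> x _; rewrite !mule_ge0.
- by rewrite mule_ge0.
apply: eq_integral => w _.
rewrite (mulrC v^-1%R) [RHS]muleCA -[X in _ = _ * X]muleA.
by congr (_ * (_ * _)); exact: muleC.
Qed.

(** The substitution [r = a / v].  The condition [f 0 = 0] discards the point
    [v = 0], where [a / v] is 0 by convention. *)
Lemma integral_inv_subst (a : R) (f : R -> R) (F : R -> \bar R) : a != 0%R ->
  measurable_fun setT f -> (forall x, (0 <= f x)%R) -> f 0%R = 0%R ->
  measurable_fun setT F -> (forall x, 0 <= F x) ->
  \int[lam]_v ((f v)%:E * F (a / v)%R) =
  \int[lam]_r ((`|a| / r ^+ 2 * f (a / r))%:E * F r).
Proof.
move=> a0 mf f0 f00 mF F0.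
pose H r : \bar R := (`|a / r| * f (a / r))%:E * F r.
have mH : measurable_fun setT H.
  by rewrite /H; meas.
have H0 r : 0 <= H r by rewrite mule_ge0// lee_fin mulr_ge0.
transitivity (\int[lam]_v (`|v|^-1%:E * H (a * v^-1)%R)).
  apply: eq_integral => v _; rewrite /H.
  have [->|v0] := eqVneq v 0%R; first by rewrite f00 normr0 invr0 !mul0e.
  rewrite invfM invrK mulrA divff// mul1r muleA -EFinM mulrA mulVf ?normr_eq0//.
  by rewrite mul1r.
rewrite (@integral_haar_inv (fun v => H (a * v)%R))//; last first.
  by meas.
rewrite integral_haar_scale//; apply: eq_integral => r _;
  rewrite /H muleA -EFinM.
congr (_%:E * _); rewrite mulrA normrM normfV mulrCA -invfM -expr2.
by rewrite real_normK ?num_real.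
Qed.

End lebesgue.

(** * Laws with a density, and independence *)

Section density.
Context d (T : measurableType d) (R : realType).
Variables (mu nu : {measure set T -> \bar R}) (f : T -> R).
Hypothesis mf : measurable_fun setT f.
Hypothesis f0 : forall x, 0 <= f x.
Local Open Scope ereal_scope.
Hypothesis nuE : forall A, measurable A -> nu A = \int[mu]_(x in A) (f x)%:E.
Import HBNNSimple.

Let integral_density_nnsfun (h : {nnsfun T >-> R}) :
  \int[nu]_x (h x)%:E = \int[mu]_x ((f x)%:E * (h x)%:E).
Proof.
rewrite integralT_nnsfun sintegralE.
under [RHS]eq_integral.
  move=> x _; rewrite fimfunE -fsumEFin// ge0_mule_fsumr; last first.
    by move=> r; rewrite EFinM nnfun_muleindic_ge0.
  over.
rewrite ge0_integral_fsum//; last 2 first.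
- move=> r; apply: emeasurable_funM; first exact/measurable_EFinP.
  exact/measurable_EFinP/measurable_funM.
- move=> r x _; apply: mule_ge0; first by rewrite lee_fin.
  by rewrite EFinM nnfun_muleindic_ge0.
apply: eq_fsbigr => r; rewrite inE => -[t _ <-].
have mh : measurable (h @^-1` [set h t]) by exact: measurable_sfunP.
rewrite nuE// integral_mkcond -ge0_integralZl//; last 3 first.
- apply/(measurable_restrictT _ mh).1; apply: measurable_funTS.
  exact/measurable_EFinP.
- by move=> x _; rewrite patchE; case: ifP => // _; rewrite lee_fin.
- by rewrite lee_fin.
apply: eq_integral => x _; rewrite patchE indicE.
by case: ifP => _; rewrite ?mulr0 ?mule0// mulr1 muleC.
Qed.

Lemma integral_density (h : T -> \bar R) :
  measurable_fun setT h -> (forall x, 0 <= h x) ->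
  \int[nu]_x h x = \int[mu]_x ((f x)%:E * h x).
Proof.
move=> mh h0; pose h_ := nnsfun_approx measurableT mh.
have mh_ n : measurable_fun setT (fun x => (h_ n x)%:E)
  by exact/measurable_EFinP.
have cvh x : (h_ n x)%:E @[n --> \oo] --> h x.
  by apply: cvg_nnsfun_approx => //.
have ndh x : nondecreasing_seq (fun n => (h_ n x)%:E).
  by move=> a b ab; rewrite lee_fin; exact/lefP/nd_nnsfun_approx.
transitivity (limn (fun n => \int[nu]_x (h_ n x)%:E)).
  rewrite -monotone_convergence//.
  - by apply: eq_integral => x _; apply/esym/cvg_lim.
  - by move=> n x _; rewrite lee_fin.
rewrite (_ : (fun n => _) = (fun n => \int[mu]_x ((f x)%:E * (h_ n x)%:E)));
  last first.
  by apply/funext => n; exact: integral_density_nnsfun.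
rewrite -monotone_convergence//.
- apply: eq_integral => x _; apply/cvg_lim => //; apply: cvgeZl => //.
- by move=> n; apply: emeasurable_funM => //; exact/measurable_EFinP.
- by move=> n x _; rewrite mule_ge0// lee_fin.
- move=> x _ a b ab; rewrite lee_wpmul2l ?lee_fin//;
    exact/lefP/nd_nnsfun_approx.
Qed.

End density.

Section law.
Context d (T : measurableType d) (R : realType) (P : probability T R).
Local Open Scope ereal_scope.

Lemma expectation_density (X : T -> R) (f : R -> R) (h : R -> \bar R) :
  measurable_fun setT X ->
  measurable_fun setT f -> (forall x, (0 <= f x)%R) ->
  (forall A, measurable A -> P (X @^-1` A) =
    \int[lebesgue_measure]_(x in A) (f x)%:E) ->
  measurable_fun setT h -> (forall x, 0 <= h x) ->
  \int[P]_w h (X w) = \int[lebesgue_measure]_x ((f x)%:E * h x).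
Proof.
move=> mX mf f0 PE mh h0.
pose X' : T -> measurableTypeR R := X.
have mX' : measurable_fun setT X' by exact: mX.
rewrite -[LHS](@integral_push_measure _ _ _ _ R P X' mX')//.
by apply: integral_density => // A mA; exact: PE.
Qed.

Definition mfun_of d1 d2 (T1 : measurableType d1) (T2 : measurableType d2)
  (X : T1 -> T2) (mX : measurable_fun setT X) : {mfun T1 >-> T2} :=
  mfun_Sub (mem_set mX).

(** Independence as a Tonelli formula: the joint law is the product of the two
    laws because both agree on rectangles, and a second copy [w'] of the sample
    point stands for integration against the law of [Y]. *)
Lemma expectation_indep d1 d2 (T1 : measurableType d1) (T2 : measurableType d2)
  (X : T -> T1) (Y : T -> T2) (F : T1 -> T2 -> \bar R) :
  measurable_fun setT X -> measurable_fun setT Y ->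
  (forall A B, measurable A -> measurable B ->
     P ((X @^-1` A) `&` (Y @^-1` B)) = P (X @^-1` A) * P (Y @^-1` B)) ->
  measurable_fun setT (fun z => F z.1 z.2) -> (forall x y, 0 <= F x y) ->
  \int[P]_w F (X w) (Y w) = \int[P]_w \int[P]_w' F (X w) (Y w').
Proof.
move=> mX mY ind mF F0.
have mXY : measurable_fun setT (fun w => (X w, Y w)) by meas.
pose PX := distribution P (mfun_of mX); pose PY := distribution P (mfun_of mY).
transitivity (\int[PX \x PY]_z F z.1 z.2).
  rewrite -(@integral_push_measure _ _ _ _ R P _ mXY (fun z => F z.1 z.2))//.
  apply: eq_measure_integral => A mA _; apply/esym.
  by apply: product_measure_unique => // B C mB mC; exact: ind.
rewrite fubini_tonelli1// /fubini_F/=.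
transitivity (\int[PX]_x \int[P]_w' F x (Y w')).
  apply: eq_integral => x _.
  rewrite -[RHS](@integral_push_measure _ _ _ _ R P _ mY (F x))//.
  by apply: (measurableT_comp mF (g := fun y => (x, y))); meas.
rewrite -[RHS](@integral_push_measure _ _ _ _ R P _ mX (fun x => \int[P]_w' F
  x (Y w')))//.
  apply: (@measurable_fun_fubini_tonelli_F _ _ _ _ R P (fun z => F z.1 (Y
    z.2))).
  - by apply: (measurableT_comp mF (g := fun z : T1 * T => (z.1, Y z.2)));
      meas; apply: measurableT_comp => //.
  - by [].
by move=> x; exact: integral_ge0.
Qed.

End law.

(** * The density of a stick *)

Definition stick_pdf (R : realType) (theta v : R) : R :=
  if (0 < v) && (v < 1) then theta * (1 - v) `^ (theta - 1) else 0.

Definition pow_pdf (R : realType) (theta t : R) : R :=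
  if (0 < t) && (t < 1) then t `^ (theta - 1) else 0.

Section beta.
Context {R : realType}.
Variable theta : R.
Hypothesis theta0 : 0 < theta.
Local Notation lam := (@lebesgue_measure R).
Local Notation f := (stick_pdf theta).
Local Notation p := (pow_pdf theta).

Lemma stick_pdf_pow v : f v = theta * p (1 - v).
Proof.
rewrite /stick_pdf /pow_pdf subr_gt0 gtrBl.
by case: (0 < v); case: (v < 1) => //=; rewrite mulr0.
Qed.

Lemma measurable_pow_pdf : measurable_fun setT p.
Proof. by rewrite /pow_pdf; meas. Qed.

Lemma measurable_stick_pdf : measurable_fun setT f.
Proof. by rewrite /stick_pdf; meas. Qed.

Lemma pow_pdf_ge0 t : 0 <= p t.
Proof. by rewrite /pow_pdf; case: ifP => // _; exact: powR_ge0. Qed.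

Lemma stick_pdf_ge0 v : 0 <= f v.
Proof. by rewrite stick_pdf_pow mulr_ge0 ?pow_pdf_ge0// ltW. Qed.

Let mp := measurable_pow_pdf.
Let mf := measurable_stick_pdf.
Let p0 := pow_pdf_ge0.
Let f0 := stick_pdf_ge0.

Local Open Scope ereal_scope.
Hypothesis mass : \int[lam]_v (f v)%:E = 1.

Lemma integral_reflect (h : R -> \bar R) :
  measurable_fun setT h -> (forall x, 0 <= h x) ->
  \int[lam]_v h (1 - v)%R = \int[lam]_t h t.
Proof.
move=> mh h0; rewrite -(@integral_affine _ (-1) 1 h)// ?oppr_eq0//.
rewrite normrN1 mul1e; apply: eq_integral => v _; congr h; ring.
Qed.

(** The total mass of the stick density is a hypothesis here, so this
    normalisation needs no antiderivative of [t ^ (theta - 1)]. *)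
Lemma pow_pdf_mass : \int[lam]_t (p t)%:E = theta^-1%:E.
Proof.
have E : theta%:E * \int[lam]_t (p t)%:E = 1.
  rewrite -mass -ge0_integralZl//; last 3 first.
  - by meas.
  - by move=> x _; rewrite lee_fin.
  - by rewrite lee_fin ltW.
  rewrite -(@integral_reflect (fun t => theta%:E * (p t)%:E))//; last 2 first.
  - by meas.
  - by move=> x; rewrite mule_ge0// lee_fin// ltW.
  by apply: eq_integral => v _; rewrite stick_pdf_pow EFinM.
rewrite -[LHS]mul1e -(_ : theta^-1%:E * theta%:E = 1); last first.
  by rewrite -EFinM mulVf// gt_eqF.
by rewrite -muleA E mule1.
Qed.

(** The two densities [p u] and [p (1 - s / u)] multiply to
    [(u - s)^(theta - 1)], because their powers of [u] cancel. *)
Let q (u s : R) : R :=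
  if ((0 < s)%R && (s < u)%R) && (u < 1)%R then ((u - s) `^ (theta - 1))%R
  else 0%R.

Let q0 u s : (0 <= q u s)%R.
Proof. by rewrite /q; case: ifP => // _; exact: powR_ge0. Qed.

Let mq : measurable_fun setT (fun z : R * R => q z.1 z.2).
Proof. by rewrite /q; meas. Qed.

Let mqC : measurable_fun setT (fun z : R * R => q z.2 z.1).
Proof. by rewrite /q; meas. Qed.

Let mq1 s : measurable_fun setT (fun u => q u s).
Proof. by rewrite /q; meas. Qed.

Let mq2 u : measurable_fun setT (q u).
Proof. by rewrite /q; meas. Qed.

Let pq u s : (p u * p (1 - s / u))%R = q u s.
Proof.
rewrite /pow_pdf /q.
have [u0|u0] := ltP 0%R u; last first.
  rewrite mul0r; case: ifP => // /andP[/andP[s0 su] _].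
  by have := lt_trans s0 su; rewrite ltNge u0.
rewrite subr_gt0 gtrBl ltr_pdivrMr// mul1r pmulr_lgt0 ?invr_gt0//.
have [s0|s0] /= := ltP 0%R s; last by rewrite andbF mulr0.
have [su|su] /= := ltP s u; last by rewrite mulr0.
have [u1|u1] /= := ltP u 1%R; last by rewrite mul0r.
rewrite -powRM ?(ltW u0)//; last by rewrite subr_ge0 ler_pdivrMr// mul1r ltW.
by rewrite mulrBr mulr1 mulrCA divff ?mulr1// gt_eqF.
Qed.

Let int_q s : \int[lam]_u (q u s)%:E = (theta^-1 * (`|1 - s| * p (1 - s)))%:E.
Proof.
have [/andP[s0 s1]|s01] := boolP ((0 < s)%R && (s < 1)%R); last first.
  rewrite /pow_pdf subr_gt0 gtrBl andbC (negbTE s01) !mulr0.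
  apply: integral0_eq => u _; rewrite /q;
    case: ifP => // /andP[/andP[s0 su] u1].
  by move: s01; rewrite s0 (lt_trans su u1).
have mqs := mq1 s.
have s1' : (1 - s)%R != 0%R by rewrite gt_eqF// subr_gt0.
rewrite -(@integral_affine _ (1 - s)%R s (fun u => (q u s)%:E))//; last 2 first.
- by meas.
- by move=> u; rewrite lee_fin.
under eq_integral.
  move=> t _.
  have -> : q ((1 - s) * t + s) s = ((1 - s) `^ (theta - 1) * p t)%R.
    rewrite /q s0 ltrDr pmulr_rgt0 ?subr_gt0// /pow_pdf /=.
    have -> : ((1 - s) * t + s < 1)%R = (t < 1)%R.
      by rewrite -ltrBrDr gtr_pMr// subr_gt0.
    case: ifP => [/andP[t0 t1]|_]; last by rewrite mulr0.
    by rewrite addrK powRM// ltW// subr_gt0.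
  rewrite EFinM; over.
rewrite ge0_integralZl//; last 3 first.
- by meas.
- by move=> x _; rewrite lee_fin.
- by rewrite lee_fin powR_ge0.
rewrite pow_pdf_mass -!EFinM; congr EFin.
by rewrite [in RHS]/pow_pdf subr_gt0 s1 gtrBl s0/= mulrA mulrC.
Qed.

(** If [u] and [v] are independent sticks, then [(1 - u) v], weighted by
    [1 - u], is distributed as a single stick [s] weighted by [1 - s]. The
    substitution [s = (1 - u) v] leaves the double integral of [q u s * g s],
    whose inner integral in [u] is explicit. *)
Lemma stick_convolution (g : R -> \bar R) :
  measurable_fun setT g -> (forall x, 0 <= g x) ->
  \int[lam]_u ((f u * `|1 - u|)%:E * \int[lam]_v ((f v)%:E * g ((1 - u) *
    v)%R)) =
  \int[lam]_s ((f s * `|1 - s|)%:E * g s).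
Proof.
move=> mg g0.
pose h (u : R) := (theta * p u * `|u|)%:E * \int[lam]_v ((f v)%:E * g (u *
  v)%R).
have mh : measurable_fun setT h.
  rewrite /h; meas.
  apply: measurable_integral.
  - by meas.
  - by move=> *; rewrite mule_ge0// lee_fin.
have I0 u : 0 <= \int[lam]_v ((f v)%:E * g (u * v)%R).
  by apply: integral_ge0 => v _; rewrite mule_ge0// lee_fin.
have h0 u : 0 <= h u.
  by rewrite mule_ge0// lee_fin !mulr_ge0// ltW.
transitivity (\int[lam]_u h (1 - u)%R).
  by apply: eq_integral => u _; rewrite /h stick_pdf_pow.
rewrite integral_reflect//.
transitivity (\int[lam]_u \int[lam]_s ((theta ^+ 2 * q u s)%:E * g s)).
  apply: eq_integral => u _; rewrite /h.
  have [u0|u0] := eqVneq (p u) 0%R.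
    rewrite u0 mulr0 mul0r mul0e; apply/esym/integral0_eq => s _.
    by rewrite -pq u0 mul0r mulr0 mul0e.
  have uneq : u != 0%R by apply: contra_neq u0 => ->; rewrite /pow_pdf ltxx.
  rewrite EFinM -muleA.
  have -> : `|u|%:E * \int[lam]_v ((f v)%:E * g (u * v)%R) =
      \int[lam]_s ((theta * p (1 - s / u))%:E * g s).
    rewrite -[RHS](@integral_affine _ u 0)//; last 2 first.
    - by meas.
    - by move=> s; rewrite mule_ge0// lee_fin mulr_ge0// ltW.
    congr (_ * _); apply: eq_integral => v _.
    by rewrite addr0 mulrAC divff// mul1r stick_pdf_pow.
  rewrite -ge0_integralZl//; last 3 first.
  - by meas.
  - by move=> s _; rewrite mule_ge0// lee_fin mulr_ge0// ltW.
  - by rewrite lee_fin mulr_ge0// ltW.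
  by apply: eq_integral => s _; rewrite muleA -EFinM -pq; congr (_%:E * _);
    ring.
rewrite fubini_swap; last 2 first.
- by meas.
- by move=> u s; rewrite mule_ge0// lee_fin mulr_ge0// exprn_ge0// ltW.
apply: eq_integral => s _; have mqs := mq1 s.
rewrite ge0_integralZr//; last 2 first.
- by meas.
- by move=> u _; rewrite lee_fin mulr_ge0// exprn_ge0// ltW.
under eq_integral do rewrite EFinM.
rewrite ge0_integralZl//; last 3 first.
- by meas.
- by move=> u _; rewrite lee_fin.
- by rewrite lee_fin exprn_ge0// ltW.
rewrite int_q -EFinM; congr (_%:E * _); rewrite stick_pdf_pow.
have tn : theta != 0%R by rewrite gt_eqF.
by field.
Qed.

(** Let [I] be the integral of [t^theta] over (0, 1).  The area integral of [q]
    is [I / theta] when [u] is integrated first, and [1 / theta - I] when [s]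
    is; comparing the two gives [I = 1 / (theta + 1)]. *)
Lemma stick_mean : \int[lam]_u (f u * `|1 - u|)%:E = (theta / (theta + 1))%:E.
Proof.
have mp1 : measurable_fun setT (fun t : R => (`|t| * p t)%:E) by meas.
have I0 : 0 <= \int[lam]_t (`|t| * p t)%:E.
  by apply: integral_ge0 => t _; rewrite lee_fin mulr_ge0.
have E : theta^-1%:E * \int[lam]_t (`|t| * p t)%:E + \int[lam]_t (`|t| *
  p t)%:E = theta^-1%:E.
  rewrite -ge0_integralZl//; last 2 first.
  - by move=> x _; rewrite lee_fin mulr_ge0.
  - by rewrite lee_fin invr_ge0 ltW.
  have -> : \int[lam]_t (theta^-1%:E * (`|t| * p t)%:E) =
    \int[lam]_s \int[lam]_u (q u s)%:E.
    rewrite -(@integral_reflect (fun t => theta^-1%:E * (`|t| * p t)%:E));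
      last 2 first.
    - by meas.
    - by move=> x; rewrite lee_fin !mulr_ge0// invr_ge0 ltW.
    by apply: eq_integral => s _; rewrite int_q EFinM.
  rewrite fubini_swap; last 2 first.
  - by meas.
  - by move=> u s; rewrite lee_fin.
  pose r (s u : R) : R := if (s < u)%R && (u < 1)%R then p s else 0%R.
  have r0 s u : (0 <= r s u)%R by rewrite /r; case: ifP.
  have mr : measurable_fun setT (fun z => r z.1 z.2).
    by rewrite /r; meas; exact: (measurableT_comp mp).
  have mr1 u : measurable_fun setT (fun s => r s u).
    by rewrite /r; meas.
  have -> : \int[lam]_u \int[lam]_s (q u s)%:E =
    \int[lam]_u \int[lam]_s (r s u)%:E.
    apply: eq_integral => u _; have mqu := mq2 u.
    rewrite -(@integral_affine _ (-1) u (fun s => (q u s)%:E)) ?oppr_eq0//;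
      last 2 first.
    - by meas.
    - by move=> s; rewrite lee_fin.
    rewrite normrN1 mul1e; apply: eq_integral => s _; congr EFin.
    rewrite /q /r /pow_pdf.
    have -> : (0 < -1 * s + u)%R = (s < u)%R by rewrite mulN1r addrC subr_gt0.
    have -> : (-1 * s + u < u)%R = (0 < s)%R by rewrite mulN1r addrC gtrBl.
    have -> : (u - (-1 * s + u) = s)%R by ring.
    have [su|] := ltP s u => //=.
    have [s0|] := ltP 0%R s => //=; last by rewrite if_same.
    have [u1|] := ltP u 1%R => //=.
    by rewrite (lt_trans su u1).
  rewrite fubini_swap; last 2 first.
  - by meas; apply: (measurableT_comp mr (g := fun z => (z.2, z.1))); meas.
  - by move=> *; rewrite lee_fin.
  rewrite -[X in _ = X]pow_pdf_mass -ge0_integralD//; last 3 first.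
  - by move=> s _; apply: integral_ge0 => u _; rewrite lee_fin.
  - apply: measurable_integral.
    + by meas.
    + by move=> *; rewrite lee_fin.
  - by move=> t _; rewrite lee_fin mulr_ge0.
  apply: eq_integral => s _.
  have [s01|s01] := boolP ((0 < s)%R && (s < 1)%R); last first.
    have ps : p s = 0%R by rewrite /pow_pdf (negbTE s01).
    rewrite ps mulr0 adde0; apply: integral0_eq => u _.
    by rewrite /r ps if_same.
  have /andP[s0 s1] := s01.
  have mI : measurable (`]s, 1%R[%classic : set R) by exact: measurable_itv.
  have -> : \int[lam]_u (r s u)%:E = (p s * (1 - s))%:E.
    transitivity (\int[lam]_u ((p s)%:E * (\1_(`]s,
      1%R[%classic : set R) u)%:E)).
      apply: eq_integral => u _; rewrite /r indicE.
      have -> : (u \in (`]s, 1%R[%classic : set R)) = (s < u)%R && (u < 1)%R.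
        by apply/idP/idP; rewrite inE/= in_itv.
      by case: ifP => _; rewrite ?mule1 ?mule0.
    rewrite ge0_integralZl//; last 2 first.
    - by meas.
    - by rewrite lee_fin.
    rewrite integral_indic// setIT EFinM; congr (_ * _).
    by rewrite [LHS]lebesgue_measure_itv/= lte_fin s1 -EFinD.
  by rewrite -EFinD gtr0_norm// mulrC -mulrDl subrK mul1r.
have Ifin : \int[lam]_t (`|t| * p t)%:E \is a fin_num.
  rewrite ge0_fin_numE//; apply: (@le_lt_trans _ _ theta^-1%:E);
    last exact: ltry.
  by rewrite -E leeDr// mule_ge0// lee_fin invr_ge0 ltW.
have -> : \int[lam]_u (f u * `|1 - u|)%:E =
  theta%:E * \int[lam]_t (`|t| * p t)%:E.
  rewrite -ge0_integralZl//; last 2 first.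
  - by move=> x _; rewrite lee_fin mulr_ge0.
  - by rewrite lee_fin ltW.
  rewrite -(@integral_reflect (fun t => theta%:E * (`|t| * p t)%:E));
    last 2 first.
  - by meas.
  - by move=> x; rewrite lee_fin !mulr_ge0// ltW.
  by apply: eq_integral => u _; rewrite stick_pdf_pow -EFinM; congr EFin; ring.
move: E; rewrite -(fineK Ifin) -!EFinM -EFinD => -[]; set I := fine _ => E.
congr EFin.
have tn : theta != 0%R by rewrite gt_eqF.
have tn1 : (theta + 1 != 0)%R by rewrite gt_eqF// ltr_wpDr.
have : ((theta + 1) * I = 1)%R.
  by rewrite -[RHS](divff tn) -E; field.
by move=> I1; congr (_ * _)%R; apply: (mulfI tn1); rewrite I1 divff.
Qed.

End beta.

(** * Size-biased picking from the GEM sequence *)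

(** The factorisation extends from rectangles to all events of the pair, as two
    finite measures that agree on rectangles are equal. *)
Lemma indep_pair_event d (T : measurableType d) (R : realType)
  (P : probability T R) d1 d2 (T1 : measurableType d1) (T2 : measurableType d2)
  (X : T -> T1) (Y : T -> T2) (E : set T) :
  measurable_fun setT X -> measurable_fun setT Y -> measurable E ->
  (forall A B, measurable A -> measurable B ->
     P ((X @^-1` A) `&` (Y @^-1` B) `&` E) =
     (P ((X @^-1` A) `&` (Y @^-1` B)) * P E)%E) ->
  forall D, measurable D ->
     P ([set w | D (X w, Y w)] `&` E) =
     (P [set w | D (X w, Y w)] * P E)%E.
Proof.
move=> mX mY mE rect D mD.
have mXY : measurable_fun setT (fun w => (X w, Y w)) by meas.
have PE0 : 0 <= fine (P E) by rewrite fine_ge0.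
pose m1 := push_measure (mrestr P mE) mXY.
pose m2 := mscale (NngNum PE0) (push_measure P mXY).
have PEfin : P E \is a fin_num by rewrite fin_num_measure.
have m2E B : m2 B = (P [set w | B (X w, Y w)] * P E)%E.
  by rewrite /m2 /mscale/= fineK// muleC.
rewrite -m2E.
apply: (@measure_unique _ _ (T1 * T2)%type
  [set C | exists A B, [/\ measurable A, measurable B & C = A `*` B]]
  (fun=> setT) _ _ _ _ m1 m2) => //.
- rewrite measurable_prod_measurableType; congr (<<s _ >>).
  apply/seteqP; split=> [_ [A mA [B mB <-]]|_ [A [B [mA mB ->]]]].
    by exists A, B.
  by exists A => //; exists B.
- move=> _ _ [A [B [mA mB ->]]] [A' [B' [mA' mB' ->]]].
  by exists (A `&` A'), (B `&` B'); rewrite setXI; split => //;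
    exact: measurableI.
- by move=> _; exists setT, setT; rewrite setXTT; split.
- by apply/seteqP; split=> // x _; exists 0%N.
- by move=> _ [A [B [mA mB ->]]]; rewrite [RHS]m2E -rect.
- move=> _; apply: (@le_lt_trans _ _ (P setT));
    last by rewrite probability_setT ltry.
  apply: le_measure; rewrite ?inE//.
  by rewrite /= setTI.
Qed.

Section gem.
Context d (T : measurableType d) (R : realType) (P : probability T R).
Variables (theta : R) (V : nat -> {RV P >-> R}).
Hypothesis theta0 : 0 < theta.
Hypothesis hV : iid_with_density V `]0, 1[
  (fun v => theta * (1 - v) `^ (theta - 1)).
Local Notation lam := (@lebesgue_measure R).
Local Notation f := (stick_pdf theta).

Definition remainder (n : nat) (w : T) : R := \prod_(i < n) (1 - V i w).

Local Notation W := remainder.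
Local Notation y n w := (gem_seq (fun i => V i w) n).

Let mf : measurable_fun setT f := measurable_stick_pdf theta.
Let f0 : forall v, 0 <= f v := stick_pdf_ge0 theta0.

Lemma gemE n w : y n w = V n w * W n w.
Proof. by []. Qed.

Lemma remainderS n w : W n.+1 w = W n w * (1 - V n w).
Proof. by rewrite /remainder big_ord_recr. Qed.

Let mV n : measurable_fun setT (V n : T -> R) := measurable_funPT (V n).

Lemma measurable_remainder n : measurable_fun setT (W n).
Proof.
elim: n => [|n IH].
  rewrite (_ : W 0%N = fun=> 1)//.
  by apply/funext => w; rewrite /remainder big_ord0.
rewrite (_ : W n.+1 = fun w => W n w * (1 - V n w)); last first.
  by apply/funext => w; rewrite remainderS.
by have mVn := mV n; meas.
Qed.

Let mW := measurable_remainder.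

Lemma measurable_gem n : measurable_fun setT (fun w => y n w).
Proof.
rewrite (_ : (fun w => _) = fun w => V n w * W n w)//.
by have mWn := mW n; have mVn := mV n; meas.
Qed.

Local Open Scope ereal_scope.

Lemma stick_law i A : measurable A ->
  P (V i @^-1` A) = \int[lam]_(v in A) (f v)%:E.
Proof.
move=> mA; have [_ /(_ i A mA)] := hV; rewrite /distribution /pushforward => ->.
rewrite integral_mkcondr; apply: eq_integral => v _.
rewrite patchE /stick_pdf.
have -> : (v \in (`]0%R, 1%R[%classic : set R)) = (0 < v)%R && (v < 1)%R.
  by apply/idP/idP; rewrite inE/= in_itv.
by case: ifP.
Qed.

Lemma stick_mass : \int[lam]_v (f v)%:E = 1.
Proof.
by rewrite -(@probability_setT _ _ _ P) -(stick_law 0 measurableT)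
  preimage_setT.
Qed.

Let preV_measurable i A : measurable A -> measurable (V i @^-1` A).
Proof. by move=> mA; rewrite -[X in measurable X]setTI;
  exact: measurable_funP. Qed.

(** Carrying all later sticks [V_i], [i >= n], through the induction lets the
    step apply the hypothesis to [V_n] together with the sticks indexed by [s]:
    this makes [(W_n, V_n)], hence [W_(n+1)], independent of the latter. *)
Lemma remainder_indep n (s : seq nat) (A : nat -> set R) C :
  uniq s -> (forall i, i \in s -> (n <= i)%N) ->
  (forall i, measurable (A i)) -> measurable C ->
  P ((W n @^-1` C) `&` \bigcap_(i in [set` s]) (V i @^-1` A i)) =
  P (W n @^-1` C) * \prod_(i <- s) P (V i @^-1` A i).
Proof.
elim: n s A C => [|n IH] s A C us sn mA mC.
  have W0 : W 0%N = cst 1%R by apply/funext => w; rewrite /remainder big_ord0.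
  rewrite W0 preimage_cst; case: ifP => _.
    by rewrite setTI probability_setT mul1e; exact: (hV.1).
  by rewrite set0I measure0 mul0e.
pose S := \bigcap_(i in [set` s]) (V i @^-1` A i).
have mS : measurable S.
  by apply: bigcap_measurableType => i _; exact: preV_measurable.
have ns : n \notin s by apply/negP => /sn; rewrite ltnn.
have PS : P S = \prod_(i <- s) P (V i @^-1` A i) by exact: (hV.1).
pose D := [set z : R * R | C (z.1 * (1 - z.2))%R].
have mD : measurable D.
  have mg : measurable_fun setT (fun z : R * R => (z.1 * (1 - z.2))%R) by meas.
  by rewrite -[D]setTI; exact: mg.
have -> : W n.+1 @^-1` C = [set w | D (W n w, V n w)].
  by apply/seteqP; split=> w; rewrite /D/= remainderS.
rewrite -PS; apply: indep_pair_event => // B1 B2 mB1 mB2.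
pose A' i := if i == n then B2 else A i.
have A'n : A' n = B2 by rewrite /A' eqxx.
have A's i : i \in s -> A' i = A i.
  by move=> si; rewrite /A'; case: eqP => // ni; rewrite -ni si in ns.
have mA' i : measurable (A' i) by rewrite /A'; case: ifP.
have := IH [:: n] A' B1 isT _ mA' mB1; rewrite big_seq1 /A' eqxx => IH1.
rewrite (_ : [set` [:: n]] = [set n]) in IH1; last first.
  by apply/seteqP; split=> i /=; rewrite inE => /eqP.
rewrite bigcap_set1 /= ?eqxx in IH1; rewrite IH1; last first.
  by move=> i; rewrite inE => /eqP ->.
have := IH (n :: s) A' B1 _ _ mA' mB1.
rewrite big_cons A'n.
have -> : \prod_(j <- s) P (V j @^-1` A' j) = P S.
  by rewrite PS; apply: eq_big_seq => i si; rewrite A's.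
rewrite (_ : \bigcap_(i in [set` n :: s]) (V i @^-1` A' i) =
  V n @^-1` B2 `&` S).
  rewrite setIA muleA; apply.
    by rewrite /= ns.
  by move=> i; rewrite inE => /orP[/eqP ->//|/sn/ltnW].
apply/seteqP; split=> w.
  move=> H; split; first by have := H n; rewrite /A' eqxx; apply;
    rewrite /= inE eqxx.
  by move=> i /= si; have := H i; rewrite A's//; apply; rewrite /= inE si orbT.
move=> [H1 H2] i /=; rewrite inE => /orP[/eqP ->|si]; first by rewrite /A' eqxx.
by rewrite A's//; exact: H2.
Qed.

Lemma gem_expectation n (F : R -> R -> \bar R) :
  measurable_fun setT (fun z => F z.1 z.2) -> (forall x v, 0 <= F x v) ->
  \int[P]_w F (W n w) (V n w) = \int[P]_w \int[lam]_v ((f v)%:E * F (W n w) v).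
Proof.
move=> mF F0; rewrite (@expectation_indep _ _ _ P _ _ _ _ (W n) (V n))//;
  last first.
  move=> A B mA mB.
  have := @remainder_indep n [:: n] (fun=> B) A isT _ (fun=> mB) mA.
  rewrite big_seq1 (_ : [set` [:: n]] = [set n]) ?bigcap_set1; last first.
    by apply/seteqP; split=> i /=; rewrite inE => /eqP.
  by apply => i; rewrite inE => /eqP ->.
apply: eq_integral => w _.
rewrite (@expectation_density _ _ _ P (V n) f)//.
- by move=> A mA; exact: stick_law.
- by apply: (measurableT_comp mF (g := fun v => (W n w, v))); meas.
Qed.

(** A size-biased pick from the part left after [n] sticks is either the stick
    [y_n] or a size-biased pick from the part left after [n + 1] sticks. In both
    outer integrals [V n] and [V n.+1] play the part of a stick independent of
    the length left. *)
Lemma gem_step n (g : R -> \bar R) :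
  measurable_fun setT g -> (forall x, 0 <= g x) ->
  \int[P]_w (`|W n w|%:E * g (V n w * W n w)%R) =
  \int[P]_w (`|y n w|%:E * g (y n w)) +
  \int[P]_w (`|W n.+1 w|%:E * g (V n.+1 w * W n.+1 w)%R).
Proof.
move=> mg g0.
pose J x := \int[lam]_v ((f v)%:E * g (v * x)%R).
have J0 x : 0 <= J x.
  by apply: integral_ge0 => v _; rewrite mule_ge0// lee_fin.
have mJ : measurable_fun setT J.
  apply: measurable_integral; first by meas.
  by move=> *; rewrite mule_ge0// lee_fin.
rewrite (@gem_expectation n (fun x v => `|x|%:E * g (v * x)%R)); last 2 first.
- by meas.
- by move=> *; rewrite mule_ge0.
rewrite (@gem_expectation n.+1 (fun x v => `|x|%:E * g (v * x)%R));
  last 2 first.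
- by meas.
- by move=> *; rewrite mule_ge0.
rewrite (@gem_expectation n (fun x v => `|v * x|%:E * g (v * x)%R));
  last 2 first.
- by meas.
- by move=> *; rewrite mule_ge0.
transitivity (\int[P]_w \int[lam]_v ((f v)%:E * (`|v * W n w|%:E * g (v *
  W n w)%R)) +
   \int[P]_w (`|W n w * (1 - V n w)|%:E * J (W n w * (1 - V n w))%R));
     last first.
  congr (_ + _); apply: eq_integral => w _; rewrite remainderS.
  have mgx : measurable_fun setT (fun v : R => g (v * (W n w *
    (1 - V n w)))%R) by meas.
  rewrite -ge0_integralZl//.
  - by apply: eq_integral => v _; rewrite muleCA.
  - by meas.
  - by move=> v _; rewrite mule_ge0// lee_fin.
rewrite (@gem_expectation n (fun x v => `|x * (1 - v)|%:E * J (x *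
  (1 - v))%R)); last 2 first.
- by meas.
- by move=> *; rewrite mule_ge0.
have mInt (G : R -> R -> \bar R) : measurable_fun setT (fun z => G z.1 z.2) ->
    (forall x v, 0 <= G x v) ->
    measurable_fun setT (fun w => \int[lam]_v G (W n w) v).
  move=> mG G0; have := measurable_integral lam mG G0.
  by move=> mI; exact: (measurableT_comp mI (mW n)).
rewrite -[RHS]ge0_integralD//; last 4 first.
- by move=> w _; apply: integral_ge0 => v _; rewrite !mule_ge0// lee_fin.
- by apply: (mInt (fun x v => (f v)%:E * (`|v * x|%:E * g (v * x)%R)));
    [meas|move=> *; rewrite !mule_ge0// lee_fin].
- by move=> w _; apply: integral_ge0 => v _; rewrite !mule_ge0// lee_fin.
- by apply: (mInt (fun x v => (f v)%:E * (`|x * (1 - v)|%:E * J (x *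
    (1 - v))%R))); [meas|move=> *; rewrite !mule_ge0// lee_fin].
apply: eq_integral => w _; set x := W n w.
have mgx : measurable_fun setT (fun v : R => g (v * x)%R) by meas.
have -> : \int[lam]_v ((f v)%:E * (`|x * (1 - v)|%:E * J (x * (1 - v))%R)) =
    `|x|%:E * \int[lam]_s ((f s * `|1 - s|)%:E * g (s * x)%R).
  rewrite -(@stick_convolution _ _ theta0 stick_mass (fun s => g (s * x)%R))//.
  rewrite -ge0_integralZl; last 4 first.
  - exact: measurableT.
  - have : measurable_fun setT (fun v : R => \int[lam]_u ((f u)%:E *
      g ((1 - v) * u * x)%R)).
      apply: measurable_integral; first by meas.
      by move=> *; rewrite mule_ge0// lee_fin.
    by move=> mI; meas.
  - move=> v _; rewrite mule_ge0// ?lee_fin ?mulr_ge0//.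
    by apply: integral_ge0 => u _; rewrite mule_ge0// lee_fin.
  - by rewrite lee_fin.
  apply: eq_integral => v _; rewrite normrM !EFinM -!muleA [LHS]muleCA.
  congr (_ * (_ * (_ * _))).
  by apply: eq_integral => u _; congr (_ * g _); ring.
have -> : \int[lam]_v ((f v)%:E * (`|v * x|%:E * g (v * x)%R)) =
    `|x|%:E * \int[lam]_s ((f s * `|s|)%:E * g (s * x)%R).
  rewrite -ge0_integralZl//; last 2 first.
  - by meas.
  - by move=> v _; rewrite mule_ge0// lee_fin mulr_ge0.
  apply: eq_integral => v _; rewrite normrM !EFinM -!muleA [RHS]muleCA.
  by congr (_ * _); rewrite [RHS]muleCA.
rewrite -ge0_muleDr; last 2 first.
- by apply: integral_ge0 => v _; rewrite mule_ge0// lee_fin mulr_ge0.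
- by apply: integral_ge0 => v _; rewrite mule_ge0// lee_fin mulr_ge0.
rewrite -ge0_integralD//; last 4 first.
- by move=> v _; rewrite mule_ge0// lee_fin mulr_ge0.
- by meas.
- by move=> v _; rewrite mule_ge0// lee_fin mulr_ge0.
- by meas.
rewrite -ge0_integralZl//; last 2 first.
- by apply: emeasurable_funD; meas.
- by move=> v _; rewrite adde_ge0// mule_ge0// lee_fin mulr_ge0.
apply: eq_integral => v _; rewrite muleCA; congr (_ * _).
rewrite -ge0_muleDl ?lee_fin ?mulr_ge0// -EFinD -mulrDr; congr (_%:E * _).
rewrite /stick_pdf; case: ifP => [/andP[v0 v1]|]; last by rewrite mul0r.
by rewrite !gtr0_norm ?subr_gt0// addrCA subrr addr0 mulr1.
Qed.

Let partial (g : R -> \bar R) n := \sum_(m < n) \int[P]_w (`|y m w|%:E *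
  g (y m w)).

Lemma gem_telescope n (g : R -> \bar R) :
  measurable_fun setT g -> (forall x, 0 <= g x) ->
  \int[lam]_v ((f v)%:E * g v) =
  partial g n + \int[P]_w (`|W n w|%:E * g (V n w * W n w)%R).
Proof.
move=> mg g0; elim: n => [|n IH].
  rewrite /partial big_ord0 add0e -(@expectation_density _ _ _ P (V 0%N))//.
    apply: eq_integral => w _.
    by rewrite /remainder big_ord0 normr1 mul1e mulr1.
  by move=> A mA; exact: stick_law.
by rewrite IH gem_step// addeA /partial big_ord_recr.
Qed.

Lemma remainder_mean n :
  \int[P]_w `|W n w|%:E = ((theta / (theta + 1)) ^+ n)%:E.
Proof.
elim: n => [|n IH].
  under eq_integral do rewrite /remainder big_ord0 normr1.
  by rewrite integral_cst// mul1e expr0; exact: probability_setT.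
have mWn := mW n.
under eq_integral do rewrite remainderS.
rewrite (@gem_expectation n (fun x v => `|x * (1 - v)|%:E)); last 2 first.
- by meas.
- by move=> *; rewrite lee_fin.
rewrite exprSr EFinM -IH -ge0_integralZr//; last 2 first.
- by meas.
- by rewrite lee_fin divr_ge0// ltW// ltr_wpDr.
apply: eq_integral => w _.
rewrite -(@stick_mean _ _ theta0 stick_mass) -ge0_integralZl//; last 2 first.
- by meas.
- by move=> *; rewrite lee_fin mulr_ge0.
by apply: eq_integral => v _; rewrite normrM -!EFinM mulrCA.
Qed.

Let term_ge0 (g : R -> \bar R) m : (forall x, 0 <= g x) ->
  0 <= \int[P]_w (`|y m w|%:E * g (y m w)).
Proof. by move=> g0; apply: integral_ge0 => w _;
  rewrite mule_ge0// lee_fin. Qed.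

Let size_bias_le (g : R -> \bar R) :
  measurable_fun setT g -> (forall x, 0 <= g x) ->
  \sum_(m <oo) \int[P]_w (`|y m w|%:E * g (y m w)) <=
    \int[lam]_v ((f v)%:E * g v).
Proof.
move=> mg g0; apply: lime_le.
  by apply: is_cvg_nneseries => m _ _; exact: term_ge0.
apply: nearW => n; rewrite (gem_telescope n)// big_mkord leeDl//.
by apply: integral_ge0 => w _; rewrite mule_ge0// lee_fin.
Qed.

(** For bounded [g] the last term of [gem_telescope] is at most
    [C * E W_n = C * (theta / (theta + 1))^n]. *)
Let size_bias_bounded (g : R -> \bar R) (C : R) :
  measurable_fun setT g -> (forall x, 0 <= g x) -> (forall x, g x <= C%:E) ->
  \int[lam]_v ((f v)%:E * g v) <=
    \sum_(m <oo) \int[P]_w (`|y m w|%:E * g (y m w)).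
Proof.
move=> mg g0 gC; set S := \sum_(m <oo) _.
have C0 : (0 <= C)%R by rewrite -lee_fin (le_trans (g0 0%R)).
have bnd n : \int[lam]_v ((f v)%:E * g v) <=
  S + (C * (theta / (theta + 1)) ^+ n)%:E.
  rewrite (gem_telescope n)// leeD//.
    rewrite /partial -(big_mkord xpredT (fun m => \int[P]_w (`|y m w|%:E *
      g (y m w)))).
    by apply: nneseries_lim_ge => m _ _; exact: term_ge0.
  have mWn := mW n; have mVn := mV n.
  rewrite EFinM -remainder_mean -ge0_integralZl//; last by meas.
  apply: ge0_le_integral => //.
  - by move=> w _; rewrite mule_ge0// lee_fin.
  - by meas.
  - by meas.
  - by move=> w _; rewrite [leRHS]muleC lee_wpmul2l// lee_fin.
apply/lee_addgt0Pr => e e0.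
have rho1 : (`|theta / (theta + 1)| < 1)%R.
  have t1 : (0 < theta + 1)%R by rewrite ltr_wpDr.
  by rewrite ger0_norm ?divr_ge0 ?ltW// ltr_pdivrMr// mul1r ltrDl.
have : (C * (theta / (theta + 1)) ^+ n)%R @[n --> \oo] --> 0%R.
  by rewrite -(mulr0 C); apply: cvgMr; exact: cvg_expr.
move/cvgrPdist_lt => /(_ e e0)[N _ /(_ N (leqnn N))]/=.
rewrite sub0r normrN => He; apply: (le_trans (bnd N)).
by rewrite leeD2l// lee_fin ltW// (le_lt_trans _ He)// ler_norm.
Qed.

(** The law of a size-biased pick from the GEM sequence is that of a stick. One
    inequality comes from dropping the last term of [gem_telescope]; the other
    is obtained for the truncations of [g] at the integers, and then in the
    limit. *)
Lemma gem_size_bias (g : R -> \bar R) :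
  measurable_fun setT g -> (forall x, 0 <= g x) ->
  \sum_(m <oo) \int[P]_w (`|y m w|%:E * g (y m w)) =
    \int[lam]_v ((f v)%:E * g v).
Proof.
move=> mg g0; apply/eqP; rewrite eq_le size_bias_le//=.
pose gk (k : nat) x := Order.min (g x) k%:R%:E.
have gk0 k x : 0 <= gk k x by rewrite /gk le_min g0 lee_fin ler0n.
have mgk k : measurable_fun setT (gk k) by apply: measurable_mine.
have gkg k x : gk k x <= g x by rewrite /gk ge_min lexx.
have gk_nd x : nondecreasing_seq (gk ^~ x).
  move=> a b ab; rewrite /gk le_min ge_min lexx/= ge_min orbC.
  by rewrite lee_fin ler_nat ab.
have gk_cvg x : gk ^~ x @ \oo --> g x.
  rewrite /gk; case: (g x) (g0 x) => [r r0|_|//].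
    apply: cvg_near_cst; exists (Num.truncn r).+1 => // k /= rk.
    apply/eqP; rewrite eq_le ge_min lexx/= le_min lexx/= lee_fin.
    by rewrite (le_trans (ltW (truncnS_gt _)))// ler_nat.
  rewrite (_ : (fun k => _) = (fun k : nat => k%:R%:E)).
    by apply/cvgeryP; exact: cvgr_idn.
  by apply/funext => k; apply/min_idPr; rewrite leey.
have <- : limn (fun k => \int[lam]_v ((f v)%:E * gk k v)) =
  \int[lam]_v ((f v)%:E * g v).
  rewrite -monotone_convergence//.
  - by apply: eq_integral => v _; apply/cvg_lim => //; apply: cvgeZl.
  - by move=> k; have := mgk k; move=> m1; meas.
  - by move=> k v _; rewrite mule_ge0// lee_fin.
  - by move=> v _ a b ab; rewrite lee_wpmul2l ?lee_fin//; exact: gk_nd.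
apply: lime_le.
  apply: ereal_nondecreasing_is_cvgn => a b ab; apply: ge0_le_integral => //.
  - by move=> v _; rewrite mule_ge0// lee_fin.
  - by have := mgk a; move=> m1; meas.
  - by have := mgk b; move=> m1; meas.
  - by move=> v _; rewrite lee_wpmul2l ?lee_fin//; exact: gk_nd.
apply: nearW => k; apply: (le_trans (@size_bias_bounded (gk k)
  k%:R _ _ _)) => //.
  by move=> x; rewrite /gk ge_min lexx orbT.
apply: lee_nneseries => [m _ _|m _]; first exact: term_ge0.
have mym := measurable_gem m; have mgkk := mgk k.
apply: ge0_le_integral => //.
- by move=> v _; rewrite mule_ge0// lee_fin.
- by meas; apply: (measurableT_comp mgkk).
- by meas; apply: (measurableT_comp mg).
- by move=> v _; rewrite lee_wpmul2l// lee_fin.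
Qed.

End gem.

(** * Countable sums, and laws of pairs of coordinates *)

Section countable_sums.
Local Open Scope ereal_scope.
Context {R : realType} {I : countType}.

Lemma esum_count (A : set I) (a : I -> \bar R) : (forall i, 0 <= a i) ->
  \esum_(i in A) a i =
  \sum_(n <oo) (if @pickle_inv I n is Some i then
                  if i \in A then a i else 0 else 0).
Proof.
move=> a0; pose b n := if @pickle_inv I n is Some i then
                  if i \in A then a i else 0 else 0 : \bar R.
rewrite -/b nneseries_esumT; last first.
  by move=> n; rewrite /b; case: pickle_inv => // i; case: ifP.
rewrite esum_mkcond.
transitivity (\esum_(n in range (@pickle I)) b n).
  rewrite esum_image; last by move=> i j _ _; exact: (pcan_inj (@pickleK I)).
  by apply: eq_esum => i _; rewrite /b pickleK_inv.
rewrite esum_mkcond; apply: eq_esum => n _; case: ifPn => //.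
rewrite notin_setE => nr; rewrite /b.
have := @pickle_invK I n; case: pickle_inv => //= i pin.
by exfalso; apply: nr; exists i.
Qed.

Lemma ge0_esumZl (A : set I) (a : I -> \bar R) (r : R) : (0 <= r)%R ->
  (forall i, 0 <= a i) ->
  \esum_(i in A) (r%:E * a i) = r%:E * \esum_(i in A) a i.
Proof.
move=> r0 a0; rewrite !esum_count//; last by move=> i; rewrite mule_ge0.
rewrite -nneseriesZl; last by move=> n _; case: pickle_inv => // i; case: ifP.
apply: eq_eseriesr => n _; case: pickle_inv => [i|]; last by rewrite mule0.
by case: ifP => // _; rewrite mule0.
Qed.

Context d (T : measurableType d) (mu : {measure set T -> \bar R}).
Variables (A : set I) (a : I -> T -> \bar R).
Hypothesis ma : forall i, measurable_fun setT (a i).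
Hypothesis a0 : forall i x, 0 <= a i x.

Let b n x := if @pickle_inv I n is Some i then
                  if i \in A then a i x else 0 else 0 : \bar R.

Let mb n : measurable_fun setT (b n).
Proof. by rewrite /b; case: (@pickle_inv I n) => [i|]/=;
  [case: (i \in A)|]. Qed.

Let b0 n x : 0 <= b n x.
Proof. by rewrite /b; case: pickle_inv => // i; case: ifP. Qed.

Lemma measurable_esum : measurable_fun setT (fun x => \esum_(i in A) a i x).
Proof.
rewrite (_ : (fun x => _) = (fun x => \sum_(n <oo) b n x)).
  by apply: ge0_emeasurable_sum => // n x _ _; exact: b0.
by apply/funext => x; rewrite esum_count.
Qed.

Lemma integral_esum :
  \int[mu]_x (\esum_(i in A) a i x) = \esum_(i in A) \int[mu]_x a i x.
Proof.
under eq_integral do rewrite esum_count//.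
rewrite (@integral_nneseries _ _ _ mu _ measurableT b)//.
rewrite esum_count; last by move=> i; exact: integral_ge0.
apply: eq_eseriesr => n _; rewrite /b; case: pickle_inv => [i|].
  by case: ifP => // _; rewrite integral0.
by rewrite integral0.
Qed.

End countable_sums.

Section coordinate_laws.
Context {R : realType}.

(** Only two coordinates of a sequence are ever considered at a time, so that
    equality in law and independence of sequences are used through these
    events. *)
Lemma seq_measurable_pair (m n : nat) (C : set (R * R)) : measurable C ->
  seq_measurable [set u : nat -> R | C (u m, u n)].
Proof.
move=> mC.
pose G := \bigcup_(i in [set: nat])
        preimage_set_system setT (fun u : nat -> R => u i) measurable.
have mcoord i : measurable_fun setT (fun u : g_sigma_algebraType G => (u : nat
  -> R) i).
  move=> _ B mB; apply: sub_sigma_algebra; exists i => //; exists B => //.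
have mp : measurable_fun setT
    (fun u : g_sigma_algebraType G => ((u : nat -> R) m, (u : nat -> R) n)).
  by apply: measurable_fun_pair; exact: mcoord.
by have := mp measurableT C mC; rewrite setTI.
Qed.

Context d (T : measurableType d) (P : probability T R).
Local Open Scope ereal_scope.

Lemma same_law_pair d' (T' : measurableType d') (P' : probability T' R)
    (X : nat -> {RV P >-> R}) (X' : nat -> {RV P' >-> R}) m n (h : R -> R ->
      \bar R) :
  same_law X X' -> measurable_fun setT (fun z => h z.1 z.2) -> (forall a b,
    0 <= h a b) ->
  \int[P]_w h (X m w) (X n w) = \int[P']_w h (X' m w) (X' n w).
Proof.
move=> XX' mh h0.
have mX : measurable_fun setT (fun w => (X m w, X n w)).
  by apply: measurable_fun_pair; exact: measurable_funPT.
have mX' : measurable_fun setT (fun w => (X' m w, X' n w)).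
  by apply: measurable_fun_pair; exact: measurable_funPT.
rewrite -(@integral_push_measure _ _ _ _ R P _ mX (fun z => h z.1 z.2))//.
rewrite -(@integral_push_measure _ _ _ _ R P' _ mX' (fun z => h z.1 z.2))//.
apply: eq_measure_integral => A mA _.
exact: (XX' _ (seq_measurable_pair m n mA)).
Qed.

Lemma indep_seqs_pair (X Y : nat -> {RV P >-> R}) m n (F : R * R -> R * R ->
  \bar R) :
  independent_seqs X Y -> measurable_fun setT (fun z => F z.1 z.2) ->
  (forall a b, 0 <= F a b) ->
  \int[P]_w F (X m w, X n w) (Y m w, Y n w) =
  \int[P]_w \int[P]_w' F (X m w, X n w) (Y m w', Y n w').
Proof.
move=> XY mF F0.
apply: (@expectation_indep _ _ _ P _ _ _ _ (fun w => (X m w, X n w))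
   (fun w => (Y m w, Y n w))) => //.
- by apply: measurable_fun_pair; exact: measurable_funPT.
- by apply: measurable_fun_pair; exact: measurable_funPT.
- move=> A B mA mB.
  exact: (XY _ _ (seq_measurable_pair m n mA) (seq_measurable_pair m n mB)).
Qed.

End coordinate_laws.

(** * Moments of the Poisson-Dirichlet process *)

Section esum_nat.
Context {R : realType}.
Local Open Scope ereal_scope.

Lemma esum_pairs (c : nat -> R) : (forall n, 0 <= c n)%R ->
  \esum_(n in [set: nat]) (c n)%:E = 1 ->
  \esum_(k in [set k : nat * nat | k.1 <> k.2]) ((c k.1)%:E * (c k.2)%:E) =
  \esum_(m in [set: nat]) ((c m)%:E * (1 - c m)%:E).
Proof.
move=> c0 c1.
rewrite (_ : [set k : nat * nat | k.1 <> k.2] =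
    [set: nat] `*`` (fun m => [set n | m <> n])); last first.
  by apply/seteqP; split=> [[m n]|[m n]] /=; [|move=> []].
rewrite -(@esum_esum _ _ _ _ _ (fun m n => (c m)%:E * (c n)%:E)); last first.
  by move=> *; rewrite mule_ge0// lee_fin.
apply: eq_esum => m _; rewrite ge0_esumZl//; congr (_ * _).
have : \esum_(n in [set: nat]) (c n)%:E =
    (c m)%:E + \esum_(n in [set n | m <> n]) (c n)%:E.
  rewrite (esumID [set m])//; last by move=> *; rewrite lee_fin.
  rewrite !setTI esum_set1 ?lee_fin//; congr (_ + esum _ _).
  by apply/seteqP; split=> n /= H /esym.
rewrite c1 => E; rewrite EFinB E [X in _ = X - _]addeC addeK//.
Qed.

End esum_nat.

Section gem_as.
Context d (T : measurableType d) (R : realType) (P : probability T R).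
Variables (theta : R) (V : nat -> {RV P >-> R}).
Hypothesis theta0 : 0 < theta.
Hypothesis hV : iid_with_density V `]0, 1[
  (fun v => theta * (1 - v) `^ (theta - 1)).
Local Notation lam := (@lebesgue_measure R).
Local Notation f := (stick_pdf theta).
Local Notation W := (remainder V).
Local Notation y n w := (gem_seq (fun i => V i w) n).

Lemma stick_in_unit : {ae P, forall w, forall i, 0 < V i w < 1}.
Proof.
apply/ae_foralln => i.
have mI : measurable (`]0, 1[%classic : set R) by exact: measurable_itv.
exists (V i @^-1` (~` `]0, 1[%classic)); split.
- rewrite -[X in measurable X]setTI; apply: measurable_funP => //.
  exact: measurableC.
- apply: (etrans (stick_law hV i (measurableC mI))).
  apply: integral0_eq => v /=; rewrite in_itv/= /stick_pdf => /negP.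
  by case: ifP => //; move=> ->.
- by move=> w /= H /=; rewrite in_itv.
Qed.

Lemma gem_partial_sum n w : \sum_(m < n) y m w = 1 - W n w.
Proof.
elim: n => [|n IH]; first by rewrite big_ord0 /remainder big_ord0 subrr.
by rewrite big_ord_recr/= IH remainderS gemE; ring.
Qed.

Lemma remainder_gt0 n w : (forall i, 0 < V i w < 1) -> 0 < W n w.
Proof.
move=> H; apply: prodr_gt0 => i _; rewrite subr_gt0.
by have /andP[] := H i.
Qed.

Lemma gem_gt0 n w : (forall i, 0 < V i w < 1) -> 0 < y n w.
Proof.
move=> H; rewrite gemE mulr_gt0 ?remainder_gt0//.
by have /andP[] := H n.
Qed.

Local Open Scope ereal_scope.

Let S w := \sum_(n <oo) `|y n w|%:E.

Let S_le1 : {ae P, forall w, S w <= 1}.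
Proof.
apply: filterS stick_in_unit => w H; apply: lime_le.
  by apply: is_cvg_nneseries => *; rewrite lee_fin.
apply: nearW => n; rewrite big_mkord.
rewrite (eq_bigr (fun m : 'I_n => (y m w)%:E)); last first.
  by move=> m _; rewrite gtr0_norm// gem_gt0.
by rewrite sumEFin gem_partial_sum lee_fin gerBl ltW// remainder_gt0.
Qed.

Let mS : measurable_fun setT S.
Proof.
apply: ge0_emeasurable_sum => [n w _ _|n _]; first by rewrite lee_fin.
by have mg := measurable_gem V n; meas.
Qed.

Let S0 w : 0 <= S w.
Proof. by apply: nneseries_ge0 => *; rewrite lee_fin. Qed.

Let ES : \int[P]_w S w = 1.
Proof.
rewrite /S integral_nneseries//; last first.
  by move=> n; have mg := measurable_gem V n; meas.
rewrite -(@stick_mass _ _ _ _ _ _ hV).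
transitivity (\int[lam]_v ((f v)%:E * 1)); last first.
  by apply: eq_integral => v _; rewrite mule1.
rewrite -(gem_size_bias theta0 hV (g := fun=> 1))//.
by apply: eq_eseriesr => n _; apply: eq_integral => w _; rewrite mule1.
Qed.

(** The sum [S] of the GEM sequence is at most 1, since [1 - W_n] are its
    partial sums; and it has mean 1, by [gem_size_bias] with [g = 1]. *)
Lemma gem_total : {ae P, forall w, \esum_(n in [set: nat]) `|y n w|%:E = 1}.
Proof.
pose M w := Order.min (S w) 1.
have mM : measurable_fun setT M by apply: measurable_mine.
have M0 w : 0 <= M w by rewrite /M le_min S0 lee01.
have M1 w : M w <= 1 by rewrite /M ge_min lexx orbT.
have Mfin w : M w \is a fin_num by rewrite ge0_fin_numE// (le_lt_trans (M1
  w))// ltry.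
have EM : \int[P]_w M w = 1.
  rewrite -ES; apply: ge0_ae_eq_integral => //.
  by apply: filterS S_le1 => w Sw _; apply/min_idPl.
have mZ : measurable_fun setT (fun w => 1 - M w) by apply: emeasurable_funB.
have Z0 w : 0 <= 1 - M w by rewrite sube_ge0 ?M1 ?Mfin.
have EZ : \int[P]_w (1 - M w) = 0.
  have : \int[P]_w (1 - M w) + \int[P]_w M w = 1.
    rewrite -ge0_integralD//.
    under eq_integral do rewrite subeK//.
    by rewrite integral_cst// mul1e; exact: probability_setT.
  by rewrite EM => /(congr1 (fun z => z - 1)); rewrite addeK// subee.
have : ae_eq P setT (fun w => 1 - M w) (cst 0).
  apply/ae_eq_integral_abs => //.
  by under eq_integral do rewrite gee0_abs//.
move=> Z; near=> w.
have Zw : 1 - M w = 0 by near: w; apply: filterS Z => w; exact.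
have Sw : S w <= 1 by near: w; exact: S_le1.
rewrite -nneseries_esumT; last by move=> *; rewrite lee_fin.
rewrite -/(S w); have -> : S w = M w by apply/esym/min_idPl.
by rewrite -[LHS]add0e -Zw subeK.
Unshelve. all: by end_near. Qed.

(** By [gem_total] the sum is that of [y_m (1 - y_m)], which [gem_size_bias]
    evaluates with [g v = 1 - v]. *)
Lemma gem_pairs :
  \int[P]_w (\esum_(k in [set k : nat * nat | k.1 <> k.2])
    (`|y k.1 w|%:E * `|y k.2 w|%:E)) = (theta / (theta + 1))%:E.
Proof.
have my n : measurable_fun setT (fun w => y n w) := measurable_gem V n.
transitivity (\int[P]_w (\esum_(m in [set: nat]) (`|y m w|%:E *
  `|1 - y m w|%:E))).
  apply: ge0_ae_eq_integral => //.
  - apply: measurable_esum => [k|*]; last by rewrite mule_ge0// lee_fin.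
    by have m1 := my k.1; have m2 := my k.2; meas.
  - apply: measurable_esum => [k|*]; last by rewrite mule_ge0// lee_fin.
    by have m1 := my k; meas.
  - by move=> w _; apply: esum_ge0 => *; rewrite mule_ge0// lee_fin.
  - by move=> w _; apply: esum_ge0 => *; rewrite mule_ge0// lee_fin.
  near=> w => _.
  have H : forall i, (0 < V i w < 1)%R by near: w; exact: stick_in_unit.
  have tot : \esum_(n in [set: nat]) `|y n w|%:E = 1.
    by near: w; exact: gem_total.
  rewrite (esum_pairs (c := fun n => `|y n w|%R))//.
  apply: eq_esum => m _; congr (_ * _%:E).
  rewrite (gtr0_norm (gem_gt0 m H)) ger0_norm// subr_ge0.
  have := gem_partial_sum m.+1 w; rewrite big_ord_recr/= => E.
  apply: (@le_trans _ _ (1 - W m.+1 w)%R);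
    last by rewrite gerBl ltW// remainder_gt0.
  rewrite -E lerDr; apply: sumr_ge0 => i _; exact/ltW/gem_gt0.
rewrite integral_esum; last 2 first.
- by move=> k; have m1 := my k; meas.
- by move=> *; rewrite mule_ge0// lee_fin.
rewrite -nneseries_esumT; last first.
  by move=> n; apply: integral_ge0 => *; rewrite mule_ge0// lee_fin.
rewrite (gem_size_bias theta0 hV (g := fun v => `|1 - v|%:E)); last 2 first.
- by meas.
- by move=> *; rewrite lee_fin.
by rewrite -(@stick_mean _ _ theta0 (stick_mass hV));
  apply: eq_integral => v _; rewrite EFinM.
Unshelve. all: by end_near. Qed.

End gem_as.

Section pd.
Context d (T : measurableType d) (R : realType) (P : probability T R).
Variables (theta : R) (x : nat -> {RV P >-> R}).
Hypothesis theta0 : 0 < theta.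
Hypothesis hx : poisson_dirichlet theta x.
Local Notation lam := (@lebesgue_measure R).
Local Notation f := (stick_pdf theta).
Local Open Scope ereal_scope.

(** The rearrangement [s] depends on the sample point, so sum and expectation
    are exchanged before the sum is reindexed. *)
Lemma pd_size_bias (g : R -> \bar R) :
  measurable_fun setT g -> (forall v, 0 <= g v) ->
  \esum_(m in [set: nat]) \int[P]_w (`|x m w|%:E * g (x m w)) =
  \int[lam]_v ((f v)%:E * g v).
Proof.
move=> mg g0; have [d' [T' [P' [V [x' [hV hr hl]]]]]] := hx.
pose y n w := gem_seq (fun i => V i w) n.
have my n : measurable_fun setT (y n) := measurable_gem V n.
have mx' n : measurable_fun setT (x' n : T' -> R) := measurable_funPT (x' n).
transitivity (\esum_(m in [set: nat]) \int[P']_w (`|x' m w|%:E * g (x' m w))).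
  apply: eq_esum => m _.
  apply: (same_law_pair m m (h := fun a _ => `|a|%:E * g a)) => //;
    first by meas.
  by move=> *; rewrite mule_ge0// lee_fin.
transitivity (\esum_(m in [set: nat]) \int[P']_w (`|y m w|%:E * g (y m w)));
  last first.
  rewrite -nneseries_esumT; last first.
    by move=> n; apply: integral_ge0 => *; rewrite mule_ge0// lee_fin.
  by rewrite (gem_size_bias theta0 hV).
rewrite -!integral_esum; last 4 first.
- by move=> n; have m1 := my n; meas.
- by move=> *; rewrite mule_ge0// lee_fin.
- by move=> n; have m1 := mx' n; meas.
- by move=> *; rewrite mule_ge0// lee_fin.
apply: ge0_ae_eq_integral => //.
- apply: measurable_esum => [n|*]; last by rewrite mule_ge0// lee_fin.
  by have m1 := mx' n; meas.
- apply: measurable_esum => [n|*]; last by rewrite mule_ge0// lee_fin.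
  by have m1 := my n; meas.
- by move=> w _; apply: esum_ge0 => *; rewrite mule_ge0// lee_fin.
- by move=> w _; apply: esum_ge0 => *; rewrite mule_ge0// lee_fin.
apply: filterS hr => w [_ [s sb xy]] _.
rewrite (@reindex_esum _ _ _ [set: nat] _ s (fun m => `|y m w|%:E * g (y m w))).
  by apply: eq_esum => m _; rewrite xy.
split=> // [m n _ _ /(bij_inj sb)//|n _].
by case: sb => r rs sr; exists (r n).
Qed.

Lemma pd_pairs :
  \esum_(k in [set k : nat * nat | k.1 <> k.2])
    \int[P]_w (`|x k.1 w|%:E * `|x k.2 w|%:E) = (theta / (theta + 1))%:E.
Proof.
have [d' [T' [P' [V [x' [hV hr hl]]]]]] := hx.
pose y n w := gem_seq (fun i => V i w) n.
have my n : measurable_fun setT (y n) := measurable_gem V n.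
have mx' n : measurable_fun setT (x' n : T' -> R) := measurable_funPT (x' n).
transitivity (\esum_(k in [set k : nat * nat | k.1 <> k.2])
    \int[P']_w (`|x' k.1 w|%:E * `|x' k.2 w|%:E)).
  apply: eq_esum => k _.
  apply: (same_law_pair k.1 k.2 (h := fun a b => `|a|%:E * `|b|%:E)) => //;
    first by meas.
rewrite -integral_esum; last 2 first.
- by move=> k; have m1 := mx' k.1; have m2 := mx' k.2; meas.
- by move=> *; rewrite mule_ge0// lee_fin.
rewrite -(gem_pairs theta0 hV); apply: ge0_ae_eq_integral => //.
- apply: measurable_esum => [k|*]; last by rewrite mule_ge0// lee_fin.
  by have m1 := mx' k.1; have m2 := mx' k.2; meas.
- apply: measurable_esum => [k|*]; last by rewrite mule_ge0// lee_fin.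
  by have m1 := my k.1; have m2 := my k.2; meas.
- by move=> w _; apply: esum_ge0 => *; rewrite mule_ge0// lee_fin.
- by move=> w _; apply: esum_ge0 => *; rewrite mule_ge0// lee_fin.
apply: filterS hr => w [_ [s sb xy]] _.
rewrite (@reindex_esum _ _ _
  [set k : nat * nat | k.1 <> k.2] _ (fun k => (s k.1, s k.2))
  (fun k => `|y k.1 w|%:E * `|y k.2 w|%:E)).
  by apply: eq_esum => m _; rewrite /= !xy.
have si : injective s by exact: bij_inj.
split.
- by move=> [a b] /= ab /si.
- by move=> [a b] [a' b'] _ _ [/si -> /si ->].
- case: sb => r rs sr [a b] /= ab; exists (r a, r b); last by rewrite /= !sr.
  by move=> /= /(congr1 s); rewrite !sr.
Qed.

Lemma pd_neq0 m : {ae P, forall w, x m w != 0%R}.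
Proof.
have [d' [T' [P' [V [x' [hV hr hl]]]]]] := hx.
have m0 : measurable [set z : R * R | z.1 = 0%R].
  rewrite (_ : [set z | _] = fst @^-1` [set 0%R]); last by apply/seteqP; split.
  by rewrite -[X in measurable X]setTI;
    exact: (@measurable_fst _ _ R R measurableT _ (measurable_set1 0%R)).
have mxm : measurable [set w | x m w = 0%R].
  rewrite -[X in measurable X]setTI.
  exact: (measurable_funPT (x m) measurableT _ (measurable_set1 0%R)).
have mxm' : measurable [set w | x' m w = 0%R].
  rewrite -[X in measurable X]setTI.
  exact: (measurable_funPT (x' m) measurableT _ (measurable_set1 0%R)).
exists [set w | x m w = 0%R]; split => //; last by move=> w /= /negP;
  rewrite negbK => /eqP.
have -> : P [set w | x m w = 0%R] = P' [set w | x' m w = 0%R].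
  exact: (hl _ (seq_measurable_pair m m m0)).
apply/negligibleP => //.
have : {ae P', forall w, ~ (x' m w = 0%R)}.
  near=> w.
  have H : forall i, (0 < V i w < 1)%R by near: w; exact: (stick_in_unit hV).
  have [_ [s sb ->]] : decreasing_rearrangement (gem_seq (V ^~ w)) (x' ^~ w).
    by near: w; exact: hr.
  by apply/eqP; rewrite gt_eqF// gem_gt0.
by apply: negligibleS => w /= xw; exact.
Unshelve. all: by end_near. Qed.

End pd.

(** * Summation over a lattice, and the series for phi *)

Section lattice.
Context {R : realType}.
Local Notation lam := (@lebesgue_measure R).
Local Notation U := (\1_(`[0, 1[%classic : set R) : R -> R).
Local Open Scope ereal_scope.

Lemma measurable_unit : measurable_fun setT U.
Proof. by apply: measurable_indic; exact: measurable_itv. Qed.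

Lemma unit_itvE u : U u = (if (0 <= u)%R && (u < 1)%R then 1%R else 0%R).
Proof.
rewrite indicE; have -> :
    (u \in (`[0%R, 1%R[%classic : set R)) = (0 <= u)%R && (u < 1)%R.
  by apply/idP/idP; rewrite inE/= in_itv.
by case: ifP.
Qed.

Let mU := measurable_unit.

Lemma lattice_sum (H : R -> \bar R) :
  measurable_fun setT H -> (forall u, 0 <= H u) ->
  \esum_(k in [set: int]) \int[lam]_u ((U u)%:E * H (k%:~R + u)%R) =
  \int[lam]_u H u.
Proof.
move=> mH H0.
transitivity (\esum_(k in [set: int]) \int[lam]_u ((U (u - k%:~R)%R)%:E * H u)).
  apply: eq_esum => k _.
  rewrite -[RHS](@integral_shift _ k%:~R)//.
  - by apply: eq_integral => u _; rewrite addrK addrC.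
  - by meas.
  - by move=> u; rewrite mule_ge0// lee_fin.
rewrite -integral_esum; last 2 first.
- by move=> k; meas.
- by move=> k u; rewrite mule_ge0// lee_fin.
apply: eq_integral => u _.
have UE (k : int) : U (u - k%:~R)%R = (if Num.floor u == k then 1%R else 0%R).
  by rewrite unit_itvE floor_eq subr_ge0 ltrBlDl intrD.
rewrite (esumID [set Num.floor u])//; last first.
  by move=> k _; rewrite mule_ge0// lee_fin.
rewrite !setTI esum_set1 ?mule_ge0 ?lee_fin// esum1 ?adde0.
  by rewrite UE eqxx mul1e.
move=> k /= uk; rewrite UE; case: eqP => [ku|_]; last by rewrite mul0e.
by exfalso; apply: uk.
Qed.

Lemma lattice_sum2 (H : R -> R -> \bar R) :
  measurable_fun setT (fun z => H z.1 z.2) -> (forall u v, 0 <= H u v) ->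
  \esum_(k in [set: int]) \esum_(l in [set: int])
    \int[lam]_u ((U u)%:E *
      \int[lam]_v ((U v)%:E * H (k%:~R + u)%R (l%:~R + v)%R)) =
  \int[lam]_u \int[lam]_v H u v.
Proof.
move=> mH H0.
have mHv (u : R) : measurable_fun setT (H u) := measurable_fun_pair2 u mH.
have mI : measurable_fun setT (fun u => \int[lam]_v H u v) by exact:
  measurable_integral.
rewrite -lattice_sum//; last by move=> u; exact: integral_ge0.
apply: eq_esum => k _.
rewrite -integral_esum; last 2 first.
- move=> l; have : measurable_fun setT (fun u : R => \int[lam]_v ((U v)%:E *
    H (k%:~R + u)%R (l%:~R + v)%R)).
    apply: measurable_integral => [|u v]; last by rewrite mule_ge0// lee_fin.
    have mg : measurable_fun setT (fun z : R * R => ((k%:~R + z.1)%R,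
      (l%:~R + z.2)%R)) by meas.
    have mHg := measurableT_comp mH mg.
    by meas; exact: mHg.
  by move=> m1; meas.
- by move=> l u; rewrite mule_ge0// ?lee_fin// integral_ge0// => v _;
    rewrite mule_ge0// lee_fin.
apply: eq_integral => u _; rewrite ge0_esumZl//; last first.
  by move=> l; rewrite integral_ge0// => v _; rewrite mule_ge0// lee_fin.
by rewrite lattice_sum.
Qed.

End lattice.

Section phi_series.
Context {R : realType}.
Variable theta : R.
Hypothesis theta0 : 0 < theta.

(** The summand of [phi] for [a = n + 1], set to 0 when [a > |x|]: a fixed range
    of summation makes [phi] visibly measurable and allows exchanging the sum
    with integrals. *)
Definition phi_term (n : nat) (x : R) : R :=
  theta / x ^+ 2 *
    (if n.+1%:R <= `|x| then n.+1%:R * (1 - n.+1%:R / `|x|) `^ (theta - 1)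
     else 0).

Lemma phi_term_ge0 n x : 0 <= phi_term n x.
Proof.
rewrite /phi_term mulr_ge0// ?divr_ge0 ?sqr_ge0 ?(ltW theta0)//.
by case: ifP => // _; rewrite mulr_ge0// powR_ge0.
Qed.

Lemma phi_termN n x : phi_term n (- x) = phi_term n x.
Proof. by rewrite /phi_term sqrrN normrN. Qed.

Lemma measurable_phi_term n : measurable_fun setT (phi_term n).
Proof. by rewrite /phi_term; meas. Qed.

Lemma phi_series x : (phi theta x)%:E =
  ((theta / (theta + 1))%:E + \sum_(n <oo) (phi_term n x)%:E)%E.
Proof.
rewrite /phi EFinD; congr (_ + _)%E.
rewrite (nneseries_split 0 (Num.truncn `|x|)); last by move=> n _;
  rewrite lee_fin phi_term_ge0.
rewrite add0n eseries0 ?adde0; last first.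
  by move=> n xn _; rewrite /phi_term -truncn_gt_nat ltnNge xn mulr0.
rewrite sumEFin; congr EFin; rewrite mulr_sumr big_add1/=.
rewrite !big_mkord; apply: eq_bigr => i _.
by rewrite /phi_term -truncn_gt_nat ltn_ord.
Qed.

Lemma phi_ge0 x : 0 <= phi theta x.
Proof.
rewrite /phi addr_ge0 ?divr_ge0 ?addr_ge0 ?(ltW theta0)//.
rewrite mulr_ge0 ?divr_ge0 ?sqr_ge0 ?(ltW theta0)//.
by apply: sumr_ge0 => a _; rewrite mulr_ge0// powR_ge0.
Qed.

Lemma measurable_phi : measurable_fun setT (phi theta).
Proof.
apply/measurable_EFinP.
rewrite (_ : EFin \o _ = fun x => ((theta / (theta + 1))%:E +
  \sum_(n <oo) (phi_term n x)%:E)%E); last first.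
  by apply/funext => x; exact: phi_series.
apply: emeasurable_funD => //.
apply: ge0_emeasurable_sum => [n x _ _|n _];
  first by rewrite lee_fin phi_term_ge0.
by have m1 := measurable_phi_term n; meas.
Qed.

End phi_series.

(** * Expected numbers of pairs of atoms *)

Section combs.
Context {R : realType} d (T : measurableType d) (P : probability T R).
Variables (x chi : nat -> {RV P >-> R}).
Hypothesis hchi : iid_uniform chi.
Hypothesis hindep : independent_seqs x chi.
Hypothesis x_neq0 : forall m, {ae P, forall w, x m w != 0}.
Local Notation lam := (@lebesgue_measure R).
Local Notation U := (\1_(`[0, 1[%classic : set R) : R -> R).
Local Open Scope ereal_scope.

Let mx m : measurable_fun setT (x m : T -> R) := measurable_funPT (x m).
Let mchi m : measurable_fun setT (chi m : T -> R) := measurable_funPT (chi m).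
Let mU : measurable_fun setT U := measurable_unit.

Lemma phase_law i A : measurable A ->
  P (chi i @^-1` A) = \int[lam]_(v in A) (U v)%:E.
Proof.
move=> mA; have [_ /(_ i A mA)] := hchi;
  rewrite /distribution /pushforward => ->.
rewrite integral_mkcondr; apply: eq_integral => v _.
by rewrite patchE indicE; case: (v \in _).
Qed.

Lemma phase_expectation i (h : R -> \bar R) :
  measurable_fun setT h -> (forall p, 0 <= h p) ->
  \int[P]_w h (chi i w) = \int[lam]_p ((U p)%:E * h p).
Proof.
move=> mh h0; apply: expectation_density => //.
by move=> A mA; exact: phase_law.
Qed.

(** The inner integrals stay separate, weighted by the density [U] of each
    phase: in this form [lattice_sum2] applies. *)
Lemma phase_expectation2 m n (h : R -> R -> \bar R) : m <> n ->
  measurable_fun setT (fun z => h z.1 z.2) -> (forall p q, 0 <= h p q) ->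
  \int[P]_w h (chi m w) (chi n w) =
  \int[lam]_p ((U p)%:E * \int[lam]_q ((U q)%:E * h p q)).
Proof.
move=> mn mh h0.
have mhp (p : R) : measurable_fun setT (h p) := measurable_fun_pair2 p mh.
rewrite (@expectation_indep _ _ _ P _ _ _ _ (chi m) (chi n))//; last first.
  move=> A B mA mB.
  pose C i := if i == m then A else B.
  have mC i : measurable (C i) by rewrite /C; case: ifP.
  have us : uniq [:: m; n] by rewrite /= inE andbT; apply/eqP.
  have := hchi.1 [:: m; n] C us mC.
  rewrite big_cons big_seq1 /C eqxx ifF; last by apply/eqP => /esym.
  move=> <-; congr (P _); apply/seteqP; split=> w.
    move=> [wA wB] i /=; rewrite !inE => /orP[|] /eqP ->; first by rewrite eqxx.
    by rewrite ifF//; apply/eqP => /esym.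
  move=> H; split; first by have := H m; rewrite eqxx; apply;
    rewrite /= inE eqxx.
  have := H n; rewrite ifF; last by apply/eqP => /esym.
  by apply; rewrite /= !inE eqxx orbT.
have mI : measurable_fun setT (fun p => \int[lam]_q ((U q)%:E * h p q)).
  apply: measurable_integral => [|p q]; last by rewrite mule_ge0// lee_fin.
  by meas; exact: mh.
rewrite -(@phase_expectation m); last 2 first.
- exact: mI.
- by move=> p; rewrite integral_ge0// => q _; rewrite mule_ge0// lee_fin.
apply: eq_integral => w _; exact: phase_expectation.
Qed.

Variable A : set (R * R).
Hypothesis mA : measurable A.

(** The length of the part of [A] on the line [t - s = r], measured by [s]. *)
Definition diagonal_length (r : R) : \bar R := \int[lam]_s (\1_A (s,
  s + r)%R)%:E.

Lemma measurable_diagonal_length : measurable_fun setT diagonal_length.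
Proof.
apply: measurable_integral => [|*]; last by rewrite lee_fin.
by meas.
Qed.

Lemma diagonal_length_ge0 r : 0 <= diagonal_length r.
Proof. by apply: integral_ge0 => s _; rewrite lee_fin. Qed.

(** Given [x], summing over [k] and [l] replaces the two independent phases by
    Lebesgue measure on the plane; scaling by the periods gives the factors
    [|x m|] and [|x n|]. *)
Lemma distinct_periods m n : m <> n ->
  \esum_(k in [set: int]) \esum_(l in [set: int])
    \int[P]_w (\1_A ((k%:~R + chi m w) / x m w,
      (l%:~R + chi n w) / x n w)%R)%:E =
  \int[P]_w (`|x m w|%:E * `|x n w|%:E) * (lam \x lam) A.
Proof.
move=> mn.
have mxm := mx m; have mxn := mx n.
pose G (k l : int) (a b : R) := \int[lam]_p ((U p)%:E * \int[lam]_q ((U q)%:E *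
  (\1_A ((k%:~R + p) / a, (l%:~R + q) / b)%R)%:E)).
have G0 k l a b : 0 <= G k l a b.
  apply: integral_ge0 => p _; apply: mule_ge0; first by rewrite lee_fin.
  by apply: integral_ge0 => q _; rewrite mule_ge0// lee_fin.
have mG k l : measurable_fun setT (fun w => G k l (x m w) (x n w)).
  rewrite /G; apply: measurable_integral => [|w p]; last first.
    apply: mule_ge0; first by rewrite lee_fin.
    by apply: integral_ge0 => q _; rewrite mule_ge0// lee_fin.
  have : measurable_fun setT (fun z : T * R => \int[lam]_q ((U q)%:E *
      (\1_A ((k%:~R + z.2) / x m z.1, (l%:~R + q) / x n z.1)%R)%:E)).
    apply: measurable_integral => [|z q]; last by rewrite mule_ge0// lee_fin.
    by meas.
  by move=> m1; meas.
transitivity (\esum_(k in [set: int]) \esum_(l in [set: int])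
    \int[P]_w G k l (x m w) (x n w)).
  apply: eq_esum => k _; apply: eq_esum => l _.
  rewrite (@indep_seqs_pair _ _ _ P x chi m n (fun a p =>
     (\1_A ((k%:~R + p.1) / a.1, (l%:~R + p.2) / a.2)%R)%:E))//; last by meas.
  apply: eq_integral => w _.
  rewrite (@phase_expectation2 m n (fun p q =>
     (\1_A ((k%:~R + p) / x m w, (l%:~R + q) / x n w)%R)%:E))//.
  by meas.
under eq_esum do rewrite -integral_esum//.
rewrite -integral_esum; last 2 first.
- by move=> k; apply: measurable_esum.
- by move=> k w; apply: esum_ge0.
rewrite -ge0_integralZr//; last by meas.
apply: ge0_ae_eq_integral => //.
- by apply: measurable_esum => [k|k w];
    [exact: measurable_esum|exact: esum_ge0].
- apply: emeasurable_funM => //; by meas.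
- by move=> w _; apply: esum_ge0 => k _; apply: esum_ge0.
- by move=> w _; rewrite !mule_ge0// lee_fin.
near=> w => _.
have a0 : (x m w != 0)%R by near: w; exact: x_neq0.
have b0 : (x n w != 0)%R by near: w; exact: x_neq0.
move: (x m w) (x n w) a0 b0 => a b a0 b0.
rewrite /G (@lattice_sum2 _ (fun p q => (\1_A (p / a, q / b)%R)%:E));
  last 2 first.
- by meas.
- by move=> *; rewrite lee_fin.
have -> : (lam \x lam) A = \int[lam]_s \int[lam]_t (\1_A (s, t))%:E.
  rewrite -[A in LHS]setIT -integral_indic// fubini_tonelli1//.
  by meas.
rewrite -muleA -ge0_integralZl//; last 2 first.
- apply: measurable_integral; last by move=> *; rewrite lee_fin.
  by meas.
- by move=> s _; apply: integral_ge0 => t _; rewrite lee_fin.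
have mI : measurable_fun setT (fun s => `|b|%:E * \int[lam]_t (\1_A (s, t))%:E).
  apply: emeasurable_funM => //; apply: measurable_integral; first by meas.
  by move=> *; rewrite lee_fin.
have I0 s : 0 <= `|b|%:E * \int[lam]_t (\1_A (s, t))%:E.
  by rewrite mule_ge0 ?lee_fin// integral_ge0// => t _; rewrite lee_fin.
transitivity (\int[lam]_u (`|b|%:E * \int[lam]_t (\1_A (u / a, t)%R)%:E)).
  apply: eq_integral => u _.
  have m1 : measurable_fun setT (fun t => (\1_A (u / a, t)%R : R)%:E) by meas.
  have := @integral_scale _ b^-1%R (fun t => (\1_A (u / a, t)%R)%:E).
  rewrite normfV invrK invr_eq0 => <-; [|exact: b0|exact: m1|by move=> *;
    rewrite lee_fin].
  by apply: eq_integral => t _; rewrite (mulrC t).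
have := @integral_scale _ a^-1%R (fun s => `|b|%:E * \int[lam]_t (\1_A (s,
  t))%:E).
rewrite normfV invrK invr_eq0 => <-; [|exact: a0|exact: mI|exact: I0].
by apply: eq_integral => u _; rewrite (mulrC u).
Unshelve. all: by end_near. Qed.

(** The two atoms share one phase, so only one coordinate is averaged: the pair
    slides along the line [t - s = a / x_m]. *)
Lemma same_period m (a : int) :
  \esum_(k in [set: int])
    \int[P]_w (\1_A ((k%:~R + chi m w) / x m w,
      ((k + a)%:~R + chi m w) / x m w)%R)%:E =
  \int[P]_w (`|x m w|%:E * diagonal_length (a%:~R / x m w)%R).
Proof.
have mxm := mx m.
pose G (k : int) (b : R) := \int[lam]_p ((U p)%:E *
  (\1_A ((k%:~R + p) / b, (k%:~R + p + a%:~R) / b)%R)%:E).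
have G0 k b : 0 <= G k b.
  by apply: integral_ge0 => p _; rewrite mule_ge0// lee_fin.
have mG k : measurable_fun setT (fun w => G k (x m w)).
  rewrite /G; apply: measurable_integral => [|w p];
    last by rewrite mule_ge0// lee_fin.
  by meas.
have mD := measurable_diagonal_length.
transitivity (\esum_(k in [set: int]) \int[P]_w G k (x m w)).
  apply: eq_esum => k _.
  transitivity (\int[P]_w (\1_A ((k%:~R + chi m w) / x m w,
    (k%:~R + chi m w + a%:~R) / x m w)%R)%:E).
    by apply: eq_integral => w _; rewrite intrD addrAC.
  rewrite (@indep_seqs_pair _ _ _ P x chi m m (fun b p =>
     (\1_A ((k%:~R + p.1) / b.1, (k%:~R + p.1 + a%:~R) / b.1)%R)%:E))//;
       last by meas.
  apply: eq_integral => w _.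
  rewrite (@phase_expectation m (fun p =>
     (\1_A ((k%:~R + p) / x m w, (k%:~R + p + a%:~R) / x m w)%R)%:E))//.
  by meas.
rewrite -integral_esum//; apply: ge0_ae_eq_integral => //.
- exact: measurable_esum.
- by meas.
- by move=> w _; exact: esum_ge0.
- by move=> w _; rewrite mule_ge0 ?lee_fin// diagonal_length_ge0.
near=> w => _.
have b0 : (x m w != 0)%R by near: w; exact: x_neq0.
move: (x m w) b0 => b b0.
rewrite /G (@lattice_sum _ (fun u => (\1_A (u / b, (u + a%:~R) / b)%R)%:E));
  last 2 first.
- by meas.
- by move=> *; rewrite lee_fin.
have m1 : measurable_fun setT (fun s : R => (\1_A (s,
  s + a%:~R / b)%R : R)%:E) by meas.
have := @integral_scale _ b^-1%R (fun s => (\1_A (s, s + a%:~R / b)%R)%:E).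
rewrite normfV invrK invr_eq0 => <-//.
by apply: eq_integral => u _; rewrite mulrDl (mulrC u).
Unshelve. all: by end_near. Qed.

End combs.

Section pairs_of_atoms.
Context {R : realType}.
Local Open Scope ereal_scope.

(** Opposite integers are paired because they contribute to the same summand of
    [phi]. *)
Lemma esum_int (c : int -> \bar R) : (forall a, 0 <= c a) ->
  \esum_(a in [set a : int | a <> 0%R]) c a =
  \sum_(n <oo) (c n.+1%:Z + c (- n.+1%:Z)%R).
Proof.
move=> c0.
rewrite (esumID [set a : int | (0 < a)%R])//.
rewrite nneseriesD//.
rewrite !nneseries_esumT//; congr (_ + _).
- rewrite (@reindex_esum _ _ _ [set: nat] _ (fun n => n.+1%:Z))//; split.
  + by move=> n _; split.
  + by move=> m n _ _ [].
  + by move=> [[|n]|n] /= [a0 apos] //; exists n.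
- rewrite (@reindex_esum _ _ _ [set: nat] _ (fun n => (- n.+1%:Z)%R))//; split.
  + by move=> n _; split.
  + by move=> m n _ _ /oppr_inj[].
  + by move=> [[|n]|n] /= [a0 apos]; [case: a0|case: apos|exists n].
Qed.

(** Two distinct indices either have different first components, or are
    [(m, k)] and [(m, k + a)] with [a] nonzero. *)
Lemma esum_atoms (c : (nat * int) * (nat * int) -> \bar R) : (forall j,
  0 <= c j) ->
  \esum_(j in [set j : (nat * int) * (nat * int) | j.1 <> j.2]) c j =
  \esum_(i in [set i : nat * nat | i.1 <> i.2]) \esum_(k in [set: int])
    \esum_(l in [set: int]) c ((i.1, k), (i.2, l)) +
  \esum_(m in [set: nat]) \esum_(a in [set a : int | a <> 0%R])
    \esum_(k in [set: int]) c ((m, k), (m, (k + a)%R)).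
Proof.
move=> c0.
rewrite (esumID [set j : (nat * int) * (nat * int) | j.1.1 <> j.2.1])//;
  congr (_ + _).
- under [RHS]eq_esum.
    move=> i _; rewrite (@esum_esum _ _ _ _ _ (fun k l => c ((i.1, k), (i.2,
      l))))//; over.
  rewrite (@esum_esum _ _ _ _ _ (fun i kl => c ((i.1, kl.1), (i.2, kl.2))))//.
  apply: (@reindex_esum _ _ _ _ _
    (fun z : (nat * nat) * (int * int) => ((z.1.1, z.2.1), (z.1.2, z.2.2)))).
  split.
  + by move=> [[m n] [k l]] /= [mn _]; split => //= -[].
  + by move=> [[m n] [k l]] [[m' n'] [k' l']] _ _ /= [-> -> -> ->].
  + by move=> [[m k] [n l]] /= [_ mn]; exists ((m, n), (k, l)).
- under [RHS]eq_esum.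
    move=> m _; rewrite (@esum_esum _ _ _ _ _ (fun a k => c ((m, k), (m,
      (k + a)%R))))//; over.
  rewrite (@esum_esum _ _ _ _ _ (fun m ak => c ((m, ak.2), (m,
    (ak.2 + ak.1)%R))))//.
  apply: (@reindex_esum _ _ _ _ _
    (fun z : nat * (int * int) => ((z.1, z.2.2), (z.1, (z.2.2 + z.2.1)%R)))).
  split.
  + move=> [m [a k]] /= [_ [a0 _]]; split; last by move=> /=; exact.
    by move=> [] /eqP; rewrite -{1}[k]addr0 (inj_eq (addrI k)) => /eqP/esym.
  + move=> [m [a k]] [m' [a' k']] _ _ /= [-> <- _].
    by move=> /addrI ->.
  + move=> [[m k] [n l]] /= [mknl /contrapT mn]; rewrite /= in mn.
    subst n; exists (m, ((l - k)%R, k)) => /=; last by rewrite addrC subrK.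
    split=> //; split=> //= /eqP; rewrite subr_eq0 => /eqP lk.
    by apply: mknl; rewrite lk.
Qed.

End pairs_of_atoms.

(** * The density of the 2-correlation measure *)

Lemma esum_swap (R : realType) (I J : choiceType) (A : set I) (B : set J)
    (c : I -> J -> \bar R) : (forall i j, 0 <= c i j)%E ->
  (\esum_(i in A) \esum_(j in B) c i j = \esum_(j in B) \esum_(i in A) c i j)%E.
Proof.
move=> c0; rewrite esum_esum// esum_esum//.
apply: (@reindex_esum _ _ _ _ _ (fun z : J * I => (z.2, z.1))).
split.
- by move=> [j i] [].
- by move=> [j i] [j' i'] _ _ /= [-> ->].
- by move=> [i j] [Ai Bj]; exists (j, i).
Qed.

Section kernel.
Context {R : realType}.
Variable theta : R.
Hypothesis theta0 : 0 < theta.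
Local Notation lam := (@lebesgue_measure R).
Local Notation f := (stick_pdf theta).

(** Including [v = 1] changes nothing almost everywhere and, after the
    substitution [r = a / v], yields the weak inequality [a <= |x|] in [phi]. *)
Definition stick_pdf_closed (v : R) : R :=
  if (0 < v) && (v <= 1) then theta * (1 - v) `^ (theta - 1) else 0.

Local Notation f1 := stick_pdf_closed.

Lemma stick_pdf_closed_ge0 v : 0 <= f1 v.
Proof.
by rewrite /f1; case: ifP => // _; rewrite mulr_ge0 ?powR_ge0// ltW.
Qed.

Lemma measurable_stick_pdf_closed : measurable_fun setT f1.
Proof. by rewrite /f1; meas. Qed.

(** The image of the stick density under [v |-> a / v]. *)
Definition gap_pdf (a : int) (r : R) : R := `|a%:~R| / r ^+ 2 * f1 (a%:~R / r).

Lemma gap_pdf_ge0 a r : 0 <= gap_pdf a r.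
Proof. by rewrite mulr_ge0 ?divr_ge0 ?sqr_ge0 ?stick_pdf_closed_ge0. Qed.

Lemma measurable_gap_pdf a : measurable_fun setT (gap_pdf a).
Proof. by have m1 := measurable_stick_pdf_closed; rewrite /gap_pdf; meas. Qed.

(** For a given sign of [r] only one of the two terms is nonzero. *)
Lemma gap_pdf_pair n r : gap_pdf n.+1%:Z r + gap_pdf (- n.+1%:Z) r =
  phi_term theta n r.
Proof.
rewrite /gap_pdf /phi_term /f1 -pmulrn mulrNz normrN -pmulrn mulNr.
have n0 : 0 < n.+1%:R :> R by rewrite ltr0n.
have [r0|r0|->] := ltgtP r 0;
  last by rewrite expr0n/= invr0 !mulr0 !mul0r addr0.
- rewrite (ltr0_norm r0) (pmulr_rgt0 _ n0) invr_gt0 (lt_gtF r0)/= mulr0 add0r.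
  rewrite -mulrN -invrN (pmulr_rgt0 _ n0) invr_gt0 oppr_gt0 r0/=.
  rewrite ler_pdivrMr ?oppr_gt0// mul1r (gtr0_norm n0).
  by case: ifP => _; rewrite ?mulr0//; ring.
- rewrite (gtr0_norm r0) (pmulr_rgt0 _ n0) invr_gt0 r0/=.
  rewrite oppr_gt0 (pmulr_rlt0 _ n0) invr_lt0 (lt_gtF r0)/= mulr0 addr0.
  rewrite ler_pdivrMr// mul1r (gtr0_norm n0).
  by case: ifP => _; rewrite ?mulr0//; ring.
Qed.

Local Open Scope ereal_scope.

Lemma integral_gap (a : int) (F : R -> \bar R) : a != 0%R ->
  measurable_fun setT F -> (forall r, 0 <= F r) ->
  \int[lam]_v ((f v)%:E * F (a%:~R / v)%R) =
    \int[lam]_r ((gap_pdf a r)%:E * F r).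
Proof.
move=> a0 mF F0.
have mf := measurable_stick_pdf theta; have mf1 := measurable_stick_pdf_closed.
rewrite -(@integral_inv_subst _ a%:~R f1)//; last 3 first.
- by rewrite intr_eq0.
- exact: stick_pdf_closed_ge0.
- by rewrite /f1 ltxx.
apply: ge0_ae_eq_integral => //.
- by meas.
- by meas.
- by move=> v _; rewrite mule_ge0// lee_fin stick_pdf_ge0.
- by move=> v _; rewrite mule_ge0// lee_fin stick_pdf_closed_ge0.
exists [set 1%R]; split; first exact: measurable_set1.
  exact: lebesgue_measure_set1.
move=> v /= H; apply: contra_notP H => v1 _; congr (_%:E * _).
by rewrite /stick_pdf /f1 le_eqVlt; move/eqP/negbTE: v1 => ->.
Qed.

Variable A : set (R * R).
Hypothesis mA : measurable A.

Lemma integral_diagonal (h : R -> R) : measurable_fun setT h ->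
  (forall r, (0 <= h r)%R) -> (forall r, h (- r)%R = h r) ->
  \int[lam]_r ((h r)%:E * diagonal_length A r) =
  \int[lam \x lam]_z ((h (z.1 - z.2))%:E * (\1_A z)%:E).
Proof.
move=> mh h0 hN.
transitivity (\int[lam]_r \int[lam]_s ((h r)%:E * (\1_A (s, s + r)%R)%:E)).
  apply: eq_integral => r _; rewrite -ge0_integralZl//.
  - by meas.
  - by rewrite lee_fin.
rewrite fubini_swap; last 2 first.
- by meas.
- by move=> r s; rewrite mule_ge0// lee_fin.
rewrite fubini_tonelli1/=; last 2 first.
- by meas.
- by move=> z; rewrite mule_ge0// lee_fin.
apply: eq_integral => s _; rewrite /fubini_F/=.
rewrite -[RHS](@integral_shift _ s)//; last 2 first.
- by meas.
- by move=> z; rewrite mule_ge0// lee_fin.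
apply: eq_integral => r _; rewrite [(r + s)%R]addrC; congr (_%:E * _).
by rewrite -[in RHS]hN opprB addrAC subrr add0r.
Qed.

End kernel.

Theorem proposition5p6 (R : realType) (theta : R) (htheta : 0 < theta)
    (d : measure_display) (T : measurableType d) (P : probability T R)
    (x chi : nat -> {RV P >-> R})
    (hx : poisson_dirichlet theta x)
    (hchi : iid_uniform chi)
    (hindep : independent_seqs x chi) :
  has_density (@lebesgue_measure R \x @lebesgue_measure R)%E
    (correlation2 P (tau_atoms x chi))
    (fun z => phi theta (z.1 - z.2)).
Proof.
have mphi := measurable_phi htheta.
have mzphi : measurable_fun setT
    (fun z : R * R => phi theta (z.1 - z.2)) by meas.
split=> [||A mA]; first exact: mzphi.
  by move=> z; exact: phi_ge0.
have mx m : measurable_fun setT (x m : T -> R) := measurable_funPT (x m).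
have mchi m : measurable_fun setT (chi m : T -> R) := measurable_funPT (chi m).
have x0 := pd_neq0 hx.
pose lam := @lebesgue_measure R.
have mD := measurable_diagonal_length mA.
have D0 := @diagonal_length_ge0 R A.
pose c (j : (nat * int) * (nat * int)) : \bar R :=
  (\int[P]_w (\1_A (tau_atoms x chi j.1 w, tau_atoms x chi j.2 w))%:E)%E.
have c0 j : (0 <= c j)%E by apply: integral_ge0 => w _; rewrite lee_fin.
have mt (j : nat * int) : measurable_fun setT (tau_atoms x chi j).
  by have m1 := mx j.1; have m2 := mchi j.1; rewrite /tau_atoms; meas.
rewrite /correlation2 integral_esum; last 2 first.
- by move=> j; have m1 := mt j.1; have m2 := mt j.2; rewrite /dirac; meas.
- by move=> j w; rewrite lee_fin.
rewrite -[LHS]/(\esum_(j in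
  [set j : (nat * int) * (nat * int) | j.1 <> j.2]) c j)%E.
rewrite esum_atoms//.
(* the constant term of phi *)
have -> : (\esum_(i in [set i : nat * nat | i.1 <> i.2]) \esum_(k in [set: int])
    \esum_(l in [set: int]) c ((i.1, k), (i.2, l)) =
    \int[lam \x lam]_z ((theta / (theta + 1))%:E * (\1_A z)%:E))%E.
  rewrite -(pd_pairs htheta hx).
  have b0 (i : nat * nat) : (0 <= \int[P]_w (`|x i.1 w|%:E * `|x i.2 w|%:E))%E.
    by apply: integral_ge0 => w _; rewrite mule_ge0// lee_fin.
  (* The measure of A may be infinite: it is kept as an integral of the
     indicator, so that only finite factors leave the sums. *)
  transitivity (\esum_(i in [set i : nat * nat | i.1 <> i.2])
    \int[lam \x lam]_z ((\1_A z)%:E * \int[P]_w (`|x i.1 w|%:E *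
      `|x i.2 w|%:E)))%E.
    apply: eq_esum => i mn.
    rewrite [LHS](distinct_periods hchi hindep x0 mA mn).
    rewrite ge0_integralZr//; last by meas.
    by rewrite integral_indic// setIT muleC.
  rewrite -integral_esum; last 2 first.
  - by move=> i; meas.
  - by move=> i z; rewrite mule_ge0// lee_fin.
  apply: eq_integral => z _; rewrite muleC ge0_esumZl//.
(* the series of phi *)
have -> : (\esum_(m in [set: nat]) \esum_(a in [set a : int | a <> 0%R])
    \esum_(k in [set: int]) c ((m, k), (m, (k + a)%R)) =
    \int[lam \x lam]_z (\sum_(n <oo) (phi_term theta n (z.1 - z.2)%R)%:E *
      (\1_A z)%:E))%E.
  transitivity (\esum_(m in [set: nat]) \esum_(a in [set a : int | a <> 0%R])
    \int[P]_w (`|x m w|%:E * diagonal_length A (a%:~R / x m w)%R))%E.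
    apply: eq_esum => m _; apply: eq_esum => a _.
    exact: (same_period hchi hindep x0 mA m a).
  rewrite esum_swap; last first.
    by move=> m a; apply: integral_ge0 => w _; rewrite mule_ge0// lee_fin.
  transitivity (\esum_(a in [set a : int | a <> 0%R])
     \int[lam]_r ((gap_pdf theta a r)%:E * diagonal_length A r))%E.
    apply: eq_esum => a /= a0.
    rewrite (pd_size_bias htheta hx (g := fun v => diagonal_length A (a%:~R /
      v)%R)).
    - by rewrite integral_gap//; exact/eqP.
    - by meas.
    - by [].
  rewrite esum_int; last first.
    by move=> a; apply: integral_ge0 => r _;
      rewrite mule_ge0// lee_fin gap_pdf_ge0.
  transitivity (\sum_(n <oo) \int[lam \x lam]_z ((phi_term theta n (z.1 -
    z.2)%R)%:E * (\1_A z)%:E))%E.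
    apply: eq_eseriesr => n _.
    have m1 := measurable_gap_pdf theta n.+1%:Z.
    have m2 := measurable_gap_pdf theta (- n.+1%:Z).
    have g0 a r := gap_pdf_ge0 htheta a r.
    rewrite -integral_diagonal//; last 3 first.
    - exact: measurable_phi_term.
    - exact: phi_term_ge0.
    - exact: phi_termN.
    rewrite -ge0_integralD//; last 4 first.
    - by move=> r _; rewrite mule_ge0// lee_fin.
    - by meas.
    - by move=> r _; rewrite mule_ge0// lee_fin.
    - by meas.
    apply: eq_integral => r _.
    by rewrite -ge0_muleDl ?lee_fin// -EFinD gap_pdf_pair.
  rewrite -integral_nneseries//; last 2 first.
  - by move=> n; have m1 := measurable_phi_term theta n; meas.
  - by move=> n z _; rewrite mule_ge0// lee_fin// phi_term_ge0.
rewrite -ge0_integralD//; last 4 first.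
- by move=> z _; rewrite mule_ge0// lee_fin// divr_ge0// ltW// ltr_wpDr.
- by meas.
- by move=> z _; apply: nneseries_ge0 => n _ _;
    rewrite mule_ge0// lee_fin// phi_term_ge0.
- apply: ge0_emeasurable_sum => [n z _ _|n _];
    first by rewrite mule_ge0// lee_fin// phi_term_ge0.
  by have m1 := measurable_phi_term theta n; meas.
rewrite [RHS]integral_mkcond; apply: eq_integral => z _.
rewrite patchE indicE; case: (z \in A); last first.
  by rewrite mule0 add0e eseries0// => n _ _; rewrite mule0.
rewrite mule1 phi_series//; congr (_ + _)%E.
by apply: eq_eseriesr => n _; rewrite mule1.
Qed.
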